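(* Fix a real constant $Q<0$. For an integer $m\ge 1$ consider the problem of finding $u:\mathbb{R}^{2m}\to\mathbb{R}$ with $$(-\Delta)^m u = Q e^{2mu}\quad\text{on }\mathbb{R}^{2m},\qquad \int_{\mathbb{R}^{2m}} e^{2mu(x)}\,dx<+\infty. \qquad ( * )$$ For $m=1$ the problem $( * )$ has no solution. For every $m\ge 2$ there exist several (i.e. more than one) radially symmetric solutions to $( * )$.
   Context: Solutions are smooth functions $u\in C^\infty(\mathbb{R}^{2m})$ (every solution of the equation is smooth). $\Delta=\sum_i \partial^2/\partial x_i^2$ is the Euclidean Laplacian. Radially symmetric means that $u(x)$ depends only on $|x|$. *)

(* Defs.v *)
From HB Require Import structures.
From mathcomp Require Import all_boot all_order all_algebra.
From mathcomp Require Import all_classical all_reals all_analysis.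

Set Implicit Arguments.
Unset Strict Implicit.
Unset Printing Implicit Defensive.

Import Order.TTheory GRing.Theory Num.Theory.
Import numFieldNormedType.Exports.

Local Open Scope classical_set_scope.
Local Open Scope ring_scope.

(** The n-fold power of a sigma-finite measure, on the library's measurable
    type of n-tuples: the point mass for n = 0, then the image under [cons] of
    the binary product measure. *)
Section tuple_product_measure.
Context d (T : measurableType d) (R : realType).
Local Open Scope ereal_scope.

Definition tcons n (p : T * n.-tuple T) : n.+1.-tuple T :=
  [tuple of p.1 :: p.2].

Lemma measurable_tcons n : measurable_fun setT (@tcons n).
Proof. exact: measurable_cons. Qed.

Section succ.
Variables (mu : {sigma_finite_measure set T -> \bar R}) (n : nat).
Variable nu : {sigma_finite_measure set (n.-tuple T) -> \bar R}.

Definition tprod_succ : set (n.+1.-tuple T) -> \bar R :=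
  pushforward (mu \x nu) (@tcons n).

Let m : {measure set (n.+1.-tuple T) -> \bar R} :=
  measure_function_pushforward__canonical__measure_function_Measure
    (mu \x nu) (@measurable_tcons n).

Let tprod_succ0 : tprod_succ set0 = 0.
Proof. exact: (measure0 m). Qed.

Let tprod_succ_ge0 A : 0 <= tprod_succ A.
Proof. exact: (measure_ge0 m). Qed.

Let tprod_succ_sigma_additive : semi_sigma_additive tprod_succ.
Proof. exact: (@measure_semi_sigma_additive _ _ _ m). Qed.

HB.instance Definition _ := isMeasure.Build _ _ _ tprod_succ
  tprod_succ0 tprod_succ_ge0 tprod_succ_sigma_additive.

Let tprod_succ_sigma_finite : sigma_finite setT tprod_succ.
Proof.
have /sigma_finiteP[F [FT ndF Foo]] := sigma_finiteT mu.
have /sigma_finiteP[G [GT ndG Goo]] := sigma_finiteT nu.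
pose g (v : n.+1.-tuple T) : T * n.-tuple T := (thead v, [tuple of behead v]).
have gK : cancel (@tcons n) g by case=> x v; congr pair; exact/val_inj.
have mg : measurable_fun setT g.
  apply/measurable_fun_pairP; split => /=; first exact: measurable_tnth.
  exact: measurable_behead.
exists (fun k => g @^-1` (F k `*` G k)).
  rewrite -preimage_bigcup (_ : \bigcup_k _ = setT) ?preimage_setT//.
  rewrite -subTset => -[x v] _.
  have [i _ Fix] : (\bigcup_k F k) x by rewrite -FT.
  have [j _ Gjv] : (\bigcup_k G k) v by rewrite -GT.
  exists (maxn i j) => //; split => /=.
    by move: x Fix; exact/subsetPset/ndF/leq_maxl.
  by move: v Gjv; exact/subsetPset/ndG/leq_maxr.
move=> k; have [mF muF] := Foo k; have [mG nuG] := Goo k; split.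
  by rewrite -[X in measurable X]setTI; apply: mg => //; exact: measurableX.
rewrite /tprod_succ /pushforward -comp_preimage (_ : g \o _ = id).
  by rewrite preimage_id product_measure1E// lte_mul_pinfty// ge0_fin_numE.
exact/funext.
Qed.

HB.instance Definition _ :=
  Measure_isSigmaFinite.Build _ _ _ tprod_succ tprod_succ_sigma_finite.
End succ.
End tuple_product_measure.

Fixpoint tprod d (T : measurableType d) (R : realType)
    (mu : {sigma_finite_measure set T -> \bar R}) (n : nat) :
    {sigma_finite_measure set (n.-tuple T) -> \bar R} :=
  if n is k.+1 then tprod_succ mu (tprod mu k)
  else \d_([tuple] : 0.-tuple T).

Lemma tprodE d (T : measurableType d) (R : realType)
    (mu : {sigma_finite_measure set T -> \bar R}) n (A : 'I_n -> set T) :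
  (forall i, measurable (A i)) ->
  tprod mu n [set v | forall i, A i (tnth v i)] = (\prod_(i < n) mu (A i))%E.
Proof.
elim: n A => [|n ih] A mA /=.
  rewrite big_ord0 diracE mem_set//= => -[]//.
rewrite big_ord_recl -(ih (fun i => A (lift ord0 i)))// /tprod_succ /pushforward.
have mB : measurable [set v : n.-tuple T | forall i, A (lift ord0 i) (tnth v i)].
  rewrite (_ : [set v | _] =
      \bigcap_(i in setT) ((@tnth n T ^~ i) @^-1` A (lift ord0 i))).
    apply: fin_bigcap_measurable => // i _; rewrite -[X in measurable X]setTI.
    exact: measurable_tnth.
  by apply/seteqP; split => v /= Av i; [move=> _|]; exact: Av.
rewrite -product_measure1E//; congr (product_measure1 _ _ _).
apply/seteqP; split => -[x v] /= Av.
  split; first exact: (Av ord0).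
  by move=> i; have := Av (lift ord0 i); rewrite tnthS.
move=> i; case: (unliftP ord0 i) => [j|] ->; last exact: Av.1.
by rewrite tnthS; exact: Av.2.
Qed.

Section euclidean_space.
Context {R : realType} {n : nat}.
Implicit Types (f : 'rV[R]_n -> R) (x : 'rV[R]_n).

Definition partial (i : 'I_n) f : 'rV[R]_n -> R :=
  fun x => 'D_(delta_mx 0 i) f x.

(** C^oo: the partial derivatives of all orders exist and are continuous;
    [s] lists the successive directions, the head being the last one. *)
Definition smooth f : Prop :=
  forall s : seq 'I_n,
    continuous (foldr partial f s) /\
    forall i x, derivable (foldr partial f s) x (delta_mx 0 i).

Definition laplacian f : 'rV[R]_n -> R :=
  fun x => \sum_(i < n) partial i (partial i f) x.

(** The library norm [`|x|] on row vectors is the sup norm. *)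
Definition eucl_norm x : R := Num.sqrt (\sum_(i < n) x 0 i ^+ 2).

Definition radially_symmetric f : Prop :=
  forall x y, eucl_norm x = eucl_norm y -> f x = f y.

Definition integral_Rn (F : 'rV[R]_n -> \bar R) : \bar R :=
  (\int[tprod lebesgue_measure n]_t F (\row_i tnth t i))%E.

End euclidean_space.

Definition is_solution {R : realType} (Q : R) (m : nat)
    (u : 'rV[R]_(2 * m) -> R) : Prop :=
  [/\ smooth u,
      forall x, iter m (fun f y => - laplacian f y) u x =
                Q * expR ((2 * m)%:R * u x) &
      (integral_Rn (fun x => (expR ((2 * m)%:R * u x))%:E) < +oo)%E].
Arguments is_solution {R} Q m u.

(* Main.v *)
Require Import Defs.
From mathcomp Require Import all_boot all_order all_algebra.
From mathcomp Require Import all_classical all_reals all_analysis.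
From mathcomp Require Import measurable_realfun ring lra.

Set Implicit Arguments.
Unset Strict Implicit.
Unset Printing Implicit Defensive.

Import Order.TTheory GRing.Theory Num.Theory.
Import numFieldNormedType.Exports.

(** Dimension two.  If [-Delta u = Q e^(2u)] on the plane with [Q < 0], compare
    [u], on the disk of squared radius [rho], with the logarithm of
    [1 / (rho - |x|^2)], which blows up on the boundary circle.  The function
    [(rho - |x|^2) e^u] attains its maximum at an interior point [x], where all
    second derivatives of [u + ln (rho - |.|^2)] are nonpositive; summing them
    ([laplacian_le_at_max]) gives
    [-Q e^(2 u x) <= 4 rho / (rho - |x|^2)^2], hence
    [-Q (rho e^(u 0))^2 <= 4 rho], which fails once [rho] is large.

    Dimension [2m] with [m = a + 1 >= 2].  A radial function is written
    [phi (|x|^2)]; in the variable [t = |x|^2] the Laplacian becomes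
    [L phi = 4 t phi'' + 4 m phi'].  Since [(t^m phi')' = t^(m-1) L phi / 4], the
    solution of [L phi = g] that vanishes at [0] is [radinv a g], obtained by
    integrating a weighted average of [g].  This operator is linear, monotone,
    and gains derivatives up to the singular point [t = 0] ([deriv0y_avg]).

    The function [L^(m-1) phi], up to an additive constant [A], is taken as the
    unknown [v].  With [|v| <= 1] and [A] large, [phi = -B + L^(-(m-1)) (v - A)]
    lies below [-B - t^(m-1) / (2m)], so [e^(2m phi)] is at most
    [e^(-2mB) e^(- t^(m-1))]: here [m >= 2] makes the source decay.  The equation
    [L v = (-1)^m Q e^(2m phi)] turns into a fixed point problem for [v] whose
    right-hand side carries the factor [e^(-2mB)].  For [B] large it is a
    contraction in the supremum norm ([profile_exists]); the decay of the
    source is what makes the primitives bounded on the whole half-line.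
    Bootstrapping through [radinv] shows that [v] is smooth, a radial profile
    smooth on the closed half-line gives a smooth function on the whole space,
    and the bound on [phi] dominates [e^(2mu)] by a product of Gaussians.
    Distinct values of [B = - u 0] give distinct solutions. *)

Local Open Scope classical_set_scope.
Local Open Scope ring_scope.

(** * Calculus on the closed half-line *)

Section half_line.
Context {R : realType}.
Implicit Types (f g F G : R -> R) (t : R).

(** Only the values of a profile on the half-line matter, because its argument
    is a squared norm. *)
Definition eq0y f g := forall t, 0 <= t -> f t = g t.

(** Precomposing with [max 0] turns continuity on the half-line into ordinary
    continuity, so that the library closure properties apply. *)
Definition cont0y f := continuous (fun t => f (Num.max 0 t)).

(** Derivatives are two-sided derivatives of some extension to negative
    arguments, even at [0]: the usual rules apply to the extensions, and so
    does the chain rule with a squared norm, which touches [0] without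
    crossing it. *)
Definition deriv0y F f :=
  exists2 G, eq0y G F & forall t, 0 <= t -> is_derive t 1 G (f t).

Lemma continuous_max0 : continuous (fun t : R => Num.max 0 t).
Proof.
move=> t; apply: (@continuous_max R R (cst 0) id t); [exact: cvg_cst|exact: cvg_id].
Qed.

Lemma max0_id t : 0 <= t -> Num.max 0 t = t. Proof. exact: max_r. Qed.

Lemma max0_ge0 t : 0 <= Num.max 0 t. Proof. by rewrite le_max lexx. Qed.

Lemma eq_cont0y f g : eq0y f g -> cont0y f -> cont0y g.
Proof.
move=> fg; rewrite /cont0y (_ : (fun t => g _) = (fun t => f (Num.max 0 t)))//.
by apply/funext => t; rewrite fg// max0_ge0.
Qed.

Lemma continuous_cont0y f : continuous f -> cont0y f.
Proof.
move=> cf t; apply: (@continuous_comp _ _ _ (fun t : R => Num.max 0 t) f).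
  exact: continuous_max0.
exact: cf.
Qed.

Lemma cont0y_cst (c : R) : cont0y (fun=> c).
Proof. by move=> t; exact: cvg_cst. Qed.

Lemma cont0yD f g : cont0y f -> cont0y g -> cont0y (fun t => f t + g t).
Proof. by move=> cf cg t; apply: cvgD; [exact: cf|exact: cg]. Qed.

Lemma cont0yM f g : cont0y f -> cont0y g -> cont0y (fun t => f t * g t).
Proof. by move=> cf cg t; apply: cvgM; [exact: cf|exact: cg]. Qed.

Lemma cont0y_comp f g : continuous g -> cont0y f -> cont0y (fun t => g (f t)).
Proof.
move=> cg cf t; apply: (@continuous_comp _ _ _ (fun t => f (Num.max 0 t)) g).
  exact: cf.
exact: cg.
Qed.

Lemma cont0yX n : cont0y (fun t => t ^+ n).
Proof. by apply: continuous_cont0y => t; exact: exprn_continuous. Qed.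

Lemma cont0y_at f t : cont0y f -> 0 < t -> {for t, continuous f}.
Proof.
move=> cf t0; have := cf t; rewrite /continuous_at /= max0_id ?ltW//.
apply: cvg_trans; apply: near_eq_cvg; near=> s.
by rewrite max0_id// ltW//; near: s; exact: lt_nbhsr.
Unshelve. all: by end_near. Qed.

Lemma deriv0y_cont F f : deriv0y F f -> cont0y F.
Proof.
move=> [G GF dG]; apply: (@eq_cont0y G) => // t.
apply: (@continuous_comp _ _ _ (fun t : R => Num.max 0 t) G).
  exact: continuous_max0.
have := dG _ (max0_ge0 t) => d.
by apply/differentiable_continuous/derivable1_diffP; case: d.
Qed.

(** Starting the integral at [-1] makes [0] an interior point, so that the
    fundamental theorem of calculus yields a two-sided derivative there. *)
Definition prim f t : R :=
  \int[lebesgue_measure]_(s in `[-1, t]) f (Num.max 0 s) -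
  \int[lebesgue_measure]_(s in `[-1, 0]) f (Num.max 0 s).

Lemma prim0 f : prim f 0 = 0. Proof. by rewrite /prim subrr. Qed.

Lemma is_derive_prim f t : cont0y f -> 0 <= t -> is_derive t 1 (prim f) (f t).
Proof.
move=> cf t0; pose g s := f (Num.max 0 s).
have tu : t < t + 1 by rewrite ltrDl.
have ig : lebesgue_measure.-integrable `[-1, t + 1] (EFin \o g).
  apply: continuous_compact_integrable; first exact: segment_compact.
  exact: continuous_subspaceT.
have at1 : (-1)%R < t by apply: lt_le_trans t0; rewrite ltrN10.
have [d1 d2] := @continuous_FTC1_closed R g (-1) t (t + 1) tu ig at1 (cf t).
have dP : is_derive t 1 (fun x => \int[lebesgue_measure]_(s in `[-1, x]) g s) (f t).
  apply: DeriveDef => //.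
  by have := d2; rewrite derive1E => ->; rewrite /g max0_id.
rewrite -[f t]subr0.
exact: is_deriveB.
Qed.

Lemma deriv0y_prim f : cont0y f -> deriv0y (prim f) f.
Proof. by move=> cf; exists (prim f) => // t; exact: is_derive_prim. Qed.

Lemma le0y_deriv F G f g t : cont0y F -> cont0y G ->
  (forall s : R, 0 < s -> is_derive s 1 F (f s)) ->
  (forall s : R, 0 < s -> is_derive s 1 G (g s)) ->
  0 <= t -> F 0 <= G 0 -> (forall s : R, 0 < s < t -> f s <= g s) -> F t <= G t.
Proof.
move=> cF cG dF dG; rewrite le_eqVlt => /predU1P[<-//|t0] FG0 fg.
pose H s := G s - F s.
have cH : cont0y H by apply: cont0yD => //; apply: (cont0y_comp _ cF); exact: opp_continuous.
have dH (s : R) : s \in `]0, t[ -> is_derive s 1 H (g s - f s).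
  rewrite in_itv/= => /andP[s0 _].
  by have := dF _ s0; have := dG _ s0 => ? ?; exact: is_deriveB.
have cHs : {within `[0, t], continuous H}.
  apply: (@subspace_eq_continuous R `[0, t]%classic R (fun s => H (Num.max 0 s))).
    by move=> s; rewrite inE/= in_itv/= => /andP[s0 _]; rewrite max0_id.
  exact: continuous_subspaceT.
have [c] := MVT t0 dH cHs; rewrite in_itv/= => ct.
rewrite /H subr0 => e.
have : 0 <= (g c - f c) * t by rewrite mulr_ge0 ?(ltW t0)// subr_ge0 fg.
rewrite -e; lra.
Qed.

Lemma eq0y_deriv F G f : cont0y F -> cont0y G ->
  (forall s : R, 0 < s -> is_derive s 1 F (f s)) ->
  (forall s : R, 0 < s -> is_derive s 1 G (f s)) -> F 0 = G 0 -> eq0y F G.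
Proof.
move=> cF cG dF dG FG0 t t0; apply/eqP; rewrite eq_le.
by rewrite (le0y_deriv cF cG dF dG)// ?FG0// (le0y_deriv cG cF dG dF)// FG0.
Qed.

Lemma prim_le f g t : cont0y f -> cont0y g -> 0 <= t ->
  (forall s : R, 0 < s < t -> f s <= g s) -> prim f t <= prim g t.
Proof.
move=> cf cg t0 fg.
apply: (@le0y_deriv (prim f) (prim g) f g) => //.
- by apply: deriv0y_cont; exact: deriv0y_prim.
- by apply: deriv0y_cont; exact: deriv0y_prim.
- by move=> s s0; apply: is_derive_prim => //; exact: ltW.
- by move=> s s0; apply: is_derive_prim => //; exact: ltW.
- by rewrite !prim0.
Qed.

Lemma prim_unique F f : cont0y F -> cont0y f ->
  (forall s : R, 0 < s -> is_derive s 1 F (f s)) -> eq0y F (fun t => F 0 + prim f t).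
Proof.
move=> cF cf dF; apply: (@eq0y_deriv _ _ f) => //.
- by apply: cont0yD; [exact: cont0y_cst|apply: deriv0y_cont; exact: deriv0y_prim].
- move=> s s0; rewrite -[f s]add0r; have ? := is_derive_prim cf (ltW s0).
  exact: is_deriveD.
- by rewrite prim0 addr0.
Qed.

(** Differentiability at the endpoint comes for free from the continuity of
    the derivative: [prim f] provides the extension. *)
Lemma deriv0y_interior F f : cont0y F -> cont0y f ->
  (forall s : R, 0 < s -> is_derive s 1 F (f s)) -> deriv0y F f.
Proof.
move=> cF cf dF; exists (fun t => F 0 + prim f t).
  by move=> t t0; rewrite [RHS](prim_unique cF cf dF).
move=> t t0; rewrite -[f t]add0r; have ? := is_derive_prim cf t0.
exact: is_deriveD.
Qed.

Lemma deriv0y_at F f t : deriv0y F f -> 0 < t -> is_derive t 1 F (f t).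
Proof.
move=> [G GF dG] t0; apply: near_eq_is_derive (dG _ (ltW t0)).
near=> s; apply: GF; rewrite ltW//; near: s; exact: lt_nbhsr.
Unshelve. all: by end_near. Qed.

Lemma deriv0yD F G f g : deriv0y F f -> deriv0y G g ->
  deriv0y (fun t => F t + G t) (fun t => f t + g t).
Proof.
move=> [F' FF dF] [G' GG dG]; exists (fun t => F' t + G' t).
  by move=> t t0; rewrite FF ?GG.
by move=> t t0; have ? := dF _ t0; have ? := dG _ t0; exact: is_deriveD.
Qed.

Lemma deriv0yM F G f g : deriv0y F f -> deriv0y G g ->
  deriv0y (fun t => F t * G t) (fun t => F t * g t + G t * f t).
Proof.
move=> [F' FF dF] [G' GG dG]; exists (fun t => F' t * G' t).
  by move=> t t0; rewrite FF ?GG.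
move=> t t0; have ? := dF _ t0; have ? := dG _ t0.
by rewrite -FF// -GG//; exact: is_deriveM.
Qed.

Lemma deriv0y_expR F f : deriv0y F f ->
  deriv0y (fun t => expR (F t)) (fun t => expR (F t) * f t).
Proof.
move=> [F' FF dF]; exists (fun t => expR (F' t)).
  by move=> t t0; rewrite FF.
move=> t t0; have ? := dF _ t0.
by rewrite -FF//; apply: is_derive1_comp.
Qed.

Lemma deriv0y_cst (c : R) : deriv0y (fun=> c) (fun=> 0).
Proof. by exists (fun=> c) => // t _; exact: is_derive_cst. Qed.

Lemma eq_deriv0y F G f g : eq0y F G -> eq0y f g -> deriv0y F f -> deriv0y G g.
Proof.
move=> FG fg [F' FF dF]; exists F' => [t t0|t t0]; first by rewrite FF// FG.
by rewrite -fg//; exact: dF.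
Qed.

End half_line.

(** * Weighted averages *)

Section avg.
Context {R : realType}.
Implicit Types (f g F G : R -> R) (t : R).

Lemma cont0y_intro f : (forall t, 0 < t -> {for t, continuous f}) ->
  (forall e : R, 0 < e -> exists2 d, 0 < d & forall t, 0 <= t < d -> `|f 0 - f t| <= e) ->
  cont0y f.
Proof.
move=> cf cf0 t; have [t0|t0|->] := ltgtP t 0.
- have : (cst (f 0) @ t --> f (Num.max 0 t)).
    by rewrite (max_l (ltW t0)); exact: cvg_cst.
  apply: cvg_trans; apply: near_eq_cvg; near=> s.
  by rewrite /= max_l// ltW//; near: s; exact: lt_nbhsl.
- have : f x @[x --> t] --> f (Num.max 0 t) by rewrite max0_id ?ltW//; exact: cf.
  apply: cvg_trans; apply: near_eq_cvg; near=> s.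
  by rewrite max0_id// ltW//; near: s; exact: lt_nbhsr.
- rewrite /continuous_at max0_id//; apply/cvgrPdist_le => e /cf0[d d0 fd].
  near=> s; apply: fd; rewrite max0_ge0/= gt_max d0/=.
  by near: s; exact: lt_nbhsl.
Unshelve. all: by end_near. Qed.

Lemma cont0y_at0 f e : cont0y f -> 0 < e ->
  exists2 d, 0 < d & forall t, 0 <= t < d -> `|f 0 - f t| <= e.
Proof.
move=> cf e0; have := cf 0; rewrite /continuous_at max0_id//.
move/cvgrPdist_le => /(_ _ e0)/nbhs_ballP[d d0 H]; exists d => // t /andP[t0 td].
have := H t; rewrite /= /ball/= sub0r normrN ger0_norm// max0_id//; exact.
Qed.

(** The average [\int_0^1 r^a g (r t) dr] of [g] over [[0, t]].  The value at
    [t = 0] is the one that makes it continuous. *)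
Definition avg a g t : R :=
  if t == 0 then g 0 / a.+1%:R else t ^- a.+1 * prim (fun s => s ^+ a * g s) t.

Lemma avg0 a g : avg a g 0 = g 0 / a.+1%:R. Proof. by rewrite /avg eqxx. Qed.

Lemma avgE a g t : t ^+ a.+1 * avg a g t = prim (fun s => s ^+ a * g s) t.
Proof.
rewrite /avg; case: eqVneq => [->|t0]; first by rewrite expr0n mul0r prim0.
by rewrite mulrA divff ?mul1r// expf_neq0.
Qed.

Lemma is_deriveXn n (t : R) : is_derive t 1 (fun s : R => s ^+ n.+1) (n.+1%:R * t ^+ n).
Proof.
have := @is_deriveX R R id n.+1 t 1 1 (is_derive_id _ _).
by rewrite exprfctE /GRing.scale/= mulr1.
Qed.

Lemma is_derive_XM n (h : R -> R) (t dh : R) : is_derive t 1 h dh ->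
  is_derive t 1 (fun t => t ^+ n.+1 * h t) (t ^+ n * (t * dh + n.+1%:R * h t)).
Proof.
move=> dhP; apply: is_derive_eq (is_deriveM (is_deriveXn n t) dhP) _.
by rewrite /GRing.scale/= exprS; ring.
Qed.

Lemma prim_monom a (c : R) t : 0 <= t ->
  prim (fun s => s ^+ a * c) t = t ^+ a.+1 * (c / a.+1%:R).
Proof.
move=> t0; have cf : cont0y (fun s => s ^+ a * c).
  by apply: cont0yM; [exact: cont0yX|exact: cont0y_cst].
have cF : cont0y (fun t => t ^+ a.+1 * (c / a.+1%:R)).
  by apply: cont0yM; [exact: cont0yX|exact: cont0y_cst].
have := prim_unique cF cf; rewrite expr0n mul0r => H.
rewrite [RHS]H ?add0r// => s s0.
apply: is_derive_eq (is_derive_XM a (is_derive_cst (c / a.+1%:R) s 1)) _.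
by rewrite mulr0 add0r /= [_%:R * _]mulrC divfK ?pnatr_eq0.
Qed.

(** At [0], an [e]-bound on [g - g 0] near [0] is inherited by the average,
    by monotonicity of the primitive. *)
Lemma cont0y_avg a g : cont0y g -> cont0y (avg a g).
Proof.
move=> cg; have cm : cont0y (fun s => s ^+ a * g s).
  by apply: cont0yM => //; exact: cont0yX.
apply: cont0y_intro => [t t0|e e0].
  have : {for t, continuous (fun t : R => t ^- a.+1 * prim (fun s => s ^+ a * g s) t)}.
    apply: continuousM.
      apply: continuousV; first by rewrite expf_neq0// gt_eqF.
      exact: exprn_continuous.
    by apply: cont0y_at => //; apply: deriv0y_cont; exact: deriv0y_prim.
  rewrite /prop_for /continuous_at {2}/avg gt_eqF//.
  apply: cvg_trans; apply: near_eq_cvg; near=> s.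
  rewrite /avg gt_eqF//; near: s; exact: lt_nbhsr.
have [d d0 gd] := cont0y_at0 cg e0; exists d => // t /andP[t0 td].
move: t0; rewrite le_eqVlt => /predU1P[<-|t0]; first by rewrite subrr normr0 ltW.
have t0' := ltW t0.
have tp : 0 < t ^+ a.+1 by rewrite exprn_gt0.
rewrite -(ler_pM2l tp) -{1}(gtr0_norm tp) -normrM mulrBr avgE avg0.
have b (s : R) : 0 < s < t -> g 0 - e <= g s <= g 0 + e.
  move=> /andP[s0 st]; have /gd : 0 <= s < d by rewrite ltW//= (lt_trans st).
  by rewrite ler_norml => /andP[? ?]; apply/andP; split; lra.
have cc (c : R) : cont0y (fun s => s ^+ a * c).
  by apply: cont0yM; [exact: cont0yX|exact: cont0y_cst].
have ee : t ^+ a.+1 * (e / a.+1%:R) <= t ^+ a.+1 * e.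
  by rewrite ler_pM2l// ler_pdivrMr ?ltr0n// ler_peMr ?ler1n// ltW.
have h1 : prim (fun s => s ^+ a * (g 0 - e)) t <= prim (fun s => s ^+ a * g s) t.
  apply: prim_le => //.
  by move=> s /[dup] /b/andP[b1 _] /andP[s0 _]; rewrite ler_pM2l// exprn_gt0.
have h2 : prim (fun s => s ^+ a * g s) t <= prim (fun s => s ^+ a * (g 0 + e)) t.
  apply: prim_le => //.
  by move=> s /[dup] /b/andP[_ b1] /andP[s0 _]; rewrite ler_pM2l// exprn_gt0.
move: h1 h2; rewrite !prim_monom// mulrBl mulrDl mulrBr mulrDr => h1 h2.
move: h1 h2 ee; set P := prim _ _; set X := t ^+ _ * (g 0 / _); set Y := _ * (e / _).
by set Z := _ * e => h1 h2 ee; rewrite ler_norml; apply/andP; split; lra.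
Unshelve. all: by end_near. Qed.

Lemma avg_le a f g t : cont0y f -> cont0y g -> 0 <= t ->
  (forall s, 0 <= s <= t -> f s <= g s) -> avg a f t <= avg a g t.
Proof.
move=> cf cg; rewrite le_eqVlt => /predU1P[<-|t0] fg.
  by rewrite !avg0 ler_pM2r ?invr_gt0 ?ltr0n// fg// lexx.
have tp : 0 < t ^+ a.+1 by rewrite exprn_gt0.
rewrite -(ler_pM2l tp) !avgE; apply: prim_le.
- by apply: cont0yM => //; exact: cont0yX.
- by apply: cont0yM => //; exact: cont0yX.
- exact: ltW.
- by move=> s /andP[s0 st]; rewrite ler_pM2l ?exprn_gt0// fg// !ltW.
Qed.

(** Multiplying by [t^(a+1)] removes the singularity, and reduces the
    identification of an average to that of a primitive. *)
Lemma avg_unique a g h : cont0y g -> cont0y h ->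
  (forall t : R, 0 < t -> is_derive t 1 (fun t => t ^+ a.+1 * h t) (t ^+ a * g t)) ->
  (h 0 = g 0 / a.+1%:R) -> eq0y (avg a g) h.
Proof.
move=> cg ch dh h0 t; rewrite le_eqVlt => /predU1P[<-|t0]; first by rewrite avg0.
have tp : t ^+ a.+1 != 0 by rewrite expf_neq0 ?gt_eqF.
apply: (mulfI tp); rewrite avgE.
have cF : cont0y (fun t => t ^+ a.+1 * h t) by apply: cont0yM => //; exact: cont0yX.
have cf : cont0y (fun t => t ^+ a * g t) by apply: cont0yM => //; exact: cont0yX.
have := prim_unique cF cf dh; rewrite expr0n mul0r => ->; first by rewrite add0r.
exact: ltW.
Qed.

Lemma is_derive_avg a g t : cont0y g -> 0 < t ->
  is_derive t 1 (avg a g) ((g t - a.+1%:R * avg a g t) / t).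
Proof.
move=> cg t0.
have cm : cont0y (fun s => s ^+ a * g s) by apply: cont0yM => //; exact: cont0yX.
have : is_derive t 1 (fun t : R => (t ^+ a.+1)^-1 * prim (fun s => s ^+ a * g s) t)
   ((g t - a.+1%:R * avg a g t) / t).
  have tn : t != 0 by rewrite gt_eqF.
  have tX : t ^+ a.+1 != 0 by rewrite expf_neq0.
  have d1 := @is_deriveV R (fun t => t ^+ a.+1) t _ 1 tX (is_deriveXn a t).
  apply: is_derive_eq (is_deriveM d1 (is_derive_prim cm (ltW t0))) _.
  by rewrite -avgE /GRing.scale/= exprS; field; rewrite tn expf_neq0.
apply: near_eq_is_derive; near=> s.
by rewrite /avg gt_eqF//; near: s; exact: lt_nbhsr.
Unshelve. all: by end_near. Qed.

(** The derivative of an average is the average of the derivative with one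
    more power of the weight.  This is why averaging, although it divides by
    [t], preserves smoothness at [0]. *)
Lemma deriv0y_avg a g g' : deriv0y g g' -> cont0y g' ->
  deriv0y (avg a g) (avg a.+1 g').
Proof.
move=> dg cg'; have cg := deriv0y_cont dg.
apply: deriv0y_interior; [exact: cont0y_avg|exact: cont0y_avg|move=> t t0].
suff -> : avg a.+1 g' t = (g t - a.+1%:R * avg a g t) / t.
  exact: is_derive_avg.
have tn : t != 0 by rewrite gt_eqF.
have tp : t ^+ a.+2 != 0 by rewrite expf_neq0.
have e : prim (fun s => s ^+ a.+1 * g' s) t = t ^+ a.+1 * (g t - a.+1%:R * avg a g t).
  (* Integration by parts: both sides vanish at 0 and have the same derivative. *)
  have cF : cont0y (fun t => t ^+ a.+1 * (g t - a.+1%:R * avg a g t)).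
    apply: cont0yM; first exact: cont0yX.
    apply: cont0yD => //; apply: (@cont0y_comp _ _ -%R); first exact: opp_continuous.
    by apply: cont0yM; [exact: cont0y_cst|exact: cont0y_avg].
  have cf : cont0y (fun s => s ^+ a.+1 * g' s) by apply: cont0yM => //; exact: cont0yX.
  have dF (s : R) : 0 < s -> is_derive s 1
      (fun t => t ^+ a.+1 * (g t - a.+1%:R * avg a g t)) (s ^+ a.+1 * g' s).
    move=> s0; have sn : s != 0 by rewrite gt_eqF.
    have dd : is_derive s 1 (fun s => g s - a.+1%:R * avg a g s) _ :=
      is_deriveB (deriv0y_at dg s0)
      (is_deriveZ a.+1%:R (is_derive_avg a cg s0)).
    apply: is_derive_eq (is_derive_XM a dd) _.
    by rewrite exprS /GRing.scale/=; field.
  by have := prim_unique cF cf dF; rewrite expr0n mul0r => ->; rewrite ?add0r// ltW.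
apply: (mulfI tp); rewrite avgE e [t ^+ a.+2]exprS; field; exact: tn.
Qed.

Lemma eq_prim f g : eq0y f g -> prim f = prim g.
Proof.
move=> fg; rewrite /prim (_ : (fun s => f _) = (fun s => g (Num.max 0 s)))//.
by apply/funext => t; rewrite fg// max0_ge0.
Qed.

Lemma prim_lin f g (c : R) t : cont0y f -> cont0y g -> 0 <= t ->
  prim (fun s => f s + c * g s) t = prim f t + c * prim g t.
Proof.
move=> cf cg t0; have cF : cont0y (fun t => prim f t + c * prim g t).
  apply: cont0yD; first by apply: deriv0y_cont; exact: deriv0y_prim.
  apply: cont0yM; first exact: cont0y_cst.
  by apply: deriv0y_cont; exact: deriv0y_prim.
have cfg : cont0y (fun s => f s + c * g s).
  by apply: cont0yD => //; apply: cont0yM => //; exact: cont0y_cst.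
have dF (s : R) : 0 < s -> is_derive s 1 (fun t => prim f t + c * prim g t) (f s + c * g s).
  move=> /ltW s0.
  exact: (is_deriveD (is_derive_prim cf s0) (is_deriveZ c (is_derive_prim cg s0))).
by have := prim_unique cF cfg dF; rewrite !prim0 mulr0 addr0 => ->//; rewrite add0r.
Qed.

Lemma eq_avg a f g : eq0y f g -> avg a f = avg a g.
Proof.
move=> fg; apply/funext => t; rewrite /avg fg//.
by rewrite (@eq_prim _ (fun s => s ^+ a * g s))// => s s0; rewrite fg.
Qed.

Lemma avg_lin a f g (c : R) t : cont0y f -> cont0y g -> 0 <= t ->
  avg a (fun s => f s + c * g s) t = avg a f t + c * avg a g t.
Proof.
move=> cf cg t0; rewrite /avg; case: eqVneq => _; first by rewrite mulrDl mulrA.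
rewrite (@eq_prim _ (fun s => s ^+ a * f s + c * (s ^+ a * g s))).
  rewrite prim_lin//; first by rewrite mulrDr mulrCA.
  - by apply: cont0yM => //; exact: cont0yX.
  - by apply: cont0yM => //; exact: cont0yX.
by move=> s _; rewrite mulrDr mulrCA.
Qed.

Lemma avg_monom a j (c : R) : eq0y (avg a (fun s => s ^+ j * c))
  (fun t => t ^+ j * (c / (a + j).+1%:R)).
Proof.
have cm n (d : R) : cont0y (fun s => s ^+ n * d).
  by apply: cont0yM; [exact: cont0yX|exact: cont0y_cst].
apply: avg_unique => //.
  move=> t t0.
  rewrite (_ : (fun t => _) = (fun t => t ^+ (a + j).+1 * (c / (a + j).+1%:R))); last first.
    by apply/funext => s; rewrite mulrA -exprD addSn.
  apply: is_derive_eq (is_derive_XM _ (is_derive_cst _ _ _)) _.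
  by rewrite mulr0 add0r /= [_%:R * _]mulrC divfK ?pnatr_eq0// mulrA -exprD.
by case: j => [|j]; rewrite ?expr0 ?addn0 ?mul1r// expr0n !mul0r.
Qed.

(** With [phi' = avg a g / 4] and [phi'' = avg a.+1 g' / 4], this is the
    equation [4 t phi'' + 4 (a + 1) phi' = g] up to [t = 0]. *)
Lemma avg_ode a g g' t : deriv0y g g' -> cont0y g' -> 0 <= t ->
  t * avg a.+1 g' t + a.+1%:R * avg a g t = g t.
Proof.
move=> dg cg'; rewrite le_eqVlt => /predU1P[<-|t0].
  by rewrite mul0r add0r avg0 mulrC divfK// pnatr_eq0.
have d1 := is_derive_avg a (deriv0y_cont dg) t0.
have d2 := deriv0y_at (deriv0y_avg a dg cg') t0.
have -> : avg a.+1 g' t = (g t - a.+1%:R * avg a g t) / t.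
  by rewrite -[LHS](@derive_val _ _ _ _ _ _ _ d2) -[RHS](@derive_val _ _ _ _ _ _ _ d1).
by field; rewrite gt_eqF.
Qed.

End avg.

(** * Inverting the radial Laplacian *)

Section radinv.
Context {R : realType}.
Implicit Types (f g F G : R -> R) (t : R).

(** The solution vanishing at [0] of [4 t phi'' + 4 (a + 1) phi' = g], that is,
    of [Delta (phi (|x|^2)) = g (|x|^2)] in dimension [2 (a + 1)]; see
    [laplacian_radinv]. *)
Definition radinv a g t : R := 4^-1 * prim (avg a g) t.

Lemma radinv0 a g : radinv a g 0 = 0. Proof. by rewrite /radinv prim0 mulr0. Qed.

Lemma eq_radinv a f g : eq0y f g -> radinv a f = radinv a g.
Proof. by move=> fg; rewrite /radinv (eq_avg a fg). Qed.

Lemma deriv0y_radinv a g : cont0y g -> deriv0y (radinv a g) (fun t => 4^-1 * avg a g t).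
Proof.
move=> cg; exists (radinv a g) => // t t0.
exact: (is_deriveZ 4^-1 (is_derive_prim (@cont0y_avg _ a _ cg) t0)).
Qed.

Lemma cont0y_radinv a g : cont0y g -> cont0y (radinv a g).
Proof. by move=> cg; exact: deriv0y_cont (deriv0y_radinv a cg). Qed.

Lemma radinv_le a f g t : cont0y f -> cont0y g -> (forall s, 0 <= s -> f s <= g s) ->
  0 <= t -> radinv a f t <= radinv a g t.
Proof.
move=> cf cg fg t0; rewrite ler_pM2l ?invr_gt0//; apply: prim_le => //.
- exact: cont0y_avg.
- exact: cont0y_avg.
- move=> s /andP[s0 _]; apply: avg_le => //; first exact: ltW.
  by move=> r /andP[r0 _]; exact: fg.
Qed.

Lemma radinv_lin a f g (c : R) t : cont0y f -> cont0y g -> 0 <= t ->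
  radinv a (fun s => f s + c * g s) t = radinv a f t + c * radinv a g t.
Proof.
move=> cf cg t0; rewrite /radinv.
rewrite (@eq_prim _ _ (fun s => avg a f s + c * avg a g s)).
  by rewrite prim_lin//; [rewrite mulrDr mulrCA|exact: cont0y_avg|exact: cont0y_avg].
by move=> s s0; exact: avg_lin.
Qed.

Lemma radinv_monom a j (c : R) : eq0y (radinv a (fun s => s ^+ j * c))
  (fun t => t ^+ j.+1 * (c / (4 * (a + j).+1%:R * j.+1%:R))).
Proof.
move=> t t0; rewrite /radinv (eq_prim (@avg_monom _ _ _ _)) prim_monom//.
by field; rewrite -natrD !nat1r !pnatr_eq0.
Qed.

(** [t ^+ j * radinv_coef a j] is the [j]-th iterate of [radinv a] on the
    constant [1], by [radinv_monom]. *)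
Fixpoint radinv_coef a j : R :=
  if j is i.+1 then radinv_coef a i / (4 * (a + i).+1%:R * i.+1%:R) else 1.

Lemma radinv_coef_gt0 a j : 0 < radinv_coef a j.
Proof. by elim: j => //= j ih; rewrite divr_gt0// !mulr_gt0 ?ltr0n. Qed.

Lemma cont0y_iter_radinv a j g : cont0y g -> cont0y (iter j (radinv a) g).
Proof. by move=> cg; elim: j => //= j; exact: cont0y_radinv. Qed.

Lemma iter_radinv_cst a j (c : R) :
  eq0y (iter j (radinv a) (fun=> c)) (fun t => t ^+ j * (c * radinv_coef a j)).
Proof.
elim: j => [|j ih] t t0 /=; first by rewrite expr0 mulr1 mul1r.
by rewrite (eq_radinv a ih) radinv_monom// -mulrA.
Qed.

Lemma iter_radinv_le a j f g t : cont0y f -> cont0y g ->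
  (forall s, 0 <= s -> f s <= g s) -> 0 <= t ->
  iter j (radinv a) f t <= iter j (radinv a) g t.
Proof.
move=> cf cg fg; elim: j t => [|j ih] t t0 /=; first exact: fg.
by apply: radinv_le => //; exact: cont0y_iter_radinv.
Qed.

Lemma iter_radinv_lin a j f g (c : R) t : cont0y f -> cont0y g -> 0 <= t ->
  iter j (radinv a) (fun s => f s + c * g s) t
  = iter j (radinv a) f t + c * iter j (radinv a) g t.
Proof.
move=> cf cg; elim: j t => [//|j ih] t t0 /=.
by rewrite (eq_radinv a ih) radinv_lin//; exact: cont0y_iter_radinv.
Qed.

Lemma is_derive_invX n (s : R) : 0 <= s ->
  is_derive s 1 (fun t => (1 + t) ^- n.+1) (- n.+1%:R * (1 + s) ^- n.+2).
Proof.
move=> s0; have s1 : 1 + s != 0 by rewrite gt_eqF// ltr_wpDr.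
have d1 : is_derive s 1 (fun t : R => 1 + t) 1.
  rewrite -[X in is_derive _ _ _ X]add0r.
  exact: (is_deriveD (is_derive_cst (1 : R) s 1) (is_derive_id s 1)).
have d2 := is_derive1_comp (is_deriveXn n (1 + s)) d1.
have sX : (1 + s) ^+ n.+1 != 0 by rewrite expf_neq0.
apply: is_derive_eq (@is_deriveV R (fun t => (1 + t) ^+ n.+1) s _ 1 sX d2) _.
by rewrite /GRing.scale/= !exprS; field; rewrite s1 expf_neq0.
Qed.

Lemma cont0y_invX n : cont0y (fun t : R => (1 + t) ^- n.+1).
Proof.
apply: deriv0y_cont.
by exists (fun t => (1 + t) ^- n.+1) => // s; exact: is_derive_invX.
Qed.

(** The decay rate [(1 + t)^-3] of a source is enough for a bounded solution:
    [(1 + t)^-2] is the average of a function [h] that dominates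
    [(1 + t)^-3], and its primitive [1 - (1 + t)^-1] is bounded.  The
    domination needs [a > 0], that is, a dimension at least four. *)
Lemma radinv_inv3_le a t : (0 < a)%N -> 0 <= t ->
  radinv a (fun t => (1 + t) ^- 3) t <= 1.
Proof.
move=> a0 t0.
have avgb s : 0 <= s -> avg a (fun t => (1 + t) ^- 3) s <= (1 + s) ^- 2.
  move=> s0.
  pose h (t : R) := - 2 * t * (1 + t) ^- 3 + a.+1%:R * (1 + t) ^- 2.
  have ch : cont0y h.
    apply: cont0yD; apply: cont0yM; try exact: cont0y_invX; try exact: cont0y_cst.
    by apply: cont0yM; [exact: cont0y_cst|apply: continuous_cont0y => x; exact: cvg_id].
  have avgh : eq0y (avg a h) (fun t => (1 + t) ^- 2).
    apply: avg_unique => //; first exact: cont0y_invX.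
      move=> r r0; apply: is_derive_eq (is_derive_XM a (is_derive_invX 1 (ltW r0))) _.
      by rewrite /h; ring.
    by rewrite /h mulr0 mul0r add0r addr0 expr1n invr1 mulr1 divff// pnatr_eq0.
  rewrite -avgh//; apply: avg_le => //; first exact: cont0y_invX.
  move=> r /andP[r0 _]; rewrite /h.
  have r1 : 0 < 1 + r by rewrite ltr_pwDl.
  have -> : (1 + r) ^- 2 = (1 + r) * (1 + r) ^- 3 by field; rewrite gt_eqF.
  rewrite mulrA -mulrDl ler_peMl ?invr_ge0 ?exprn_ge0 ?ltW//.
  have : 2 <= a.+1%:R :> R by rewrite ler_nat.
  nra.
rewrite /radinv; have b : prim (avg a (fun t => (1 + t) ^- 3)) t <= 1.
  have d (s : R) : 0 < s -> is_derive s 1 (fun t => - (1 + t) ^- 1) ((1 + s) ^- 2).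
    move=> s0; apply: is_derive_eq (is_deriveN (is_derive_invX 0 (ltW s0))) _.
    by rewrite mulN1r opprK.
  have cP : cont0y (prim (avg a (fun t => (1 + t) ^- 3))).
    by apply: deriv0y_cont; apply: deriv0y_prim; apply: cont0y_avg; exact: cont0y_invX.
  have cI : cont0y (fun t => 1 - (1 + t) ^- 1).
    apply: cont0yD; first exact: cont0y_cst.
    by apply: (@cont0y_comp _ _ -%R); [exact: opp_continuous|exact: cont0y_invX].
  have : prim (avg a (fun t => (1 + t) ^- 3)) t <= 1 - (1 + t) ^- 1.
    apply: (@le0y_deriv _ _ (fun t => 1 - (1 + t) ^- 1)
      (avg a (fun t => (1 + t) ^- 3)) (fun s => (1 + s) ^- 2)) => //.
    - move=> s s0; apply: is_derive_prim; last exact: ltW.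
      by apply: cont0y_avg; exact: cont0y_invX.
    - move=> s s0.
      rewrite -[X in is_derive _ _ _ X]add0r.
      exact: (is_deriveD (is_derive_cst (1 : R) s 1) (d s s0)).
    - by rewrite prim0 addr0 expr1n invr1 subrr.
    - by move=> s /andP[s0 _]; apply: avgb; exact: ltW.
  have : 0 <= (1 + t) ^- 1 by rewrite invr_ge0 exprn_ge0// addr_ge0.
  lra.
lra.
Qed.

Lemma radinv_bound a (c : R) f t : (0 < a)%N -> 0 <= c -> cont0y f -> 0 <= t ->
  (forall s : R, 0 <= s -> `|f s| <= c * (1 + s) ^- 3) -> `|radinv a f t| <= c.
Proof.
move=> a0 c0 cf t0 fc.
have cb (d : R) : cont0y (fun s => 0 + d * (1 + s) ^- 3).
  apply: cont0yD; first exact: cont0y_cst.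
  by apply: cont0yM; [exact: cont0y_cst|exact: cont0y_invX].
have r0 : radinv a (fun=> 0) t = 0.
  have := iter_radinv_cst a 1 0 t0; rewrite /= mul0r mulr0; exact.
have radE (d : R) : radinv a (fun s => 0 + d * (1 + s) ^- 3) t
    = d * radinv a (fun s => (1 + s) ^- 3) t.
  by rewrite radinv_lin ?r0 ?add0r//; [exact: cont0y_cst|exact: cont0y_invX].
have r1 := radinv_inv3_le a0 t0.
have r2 : 0 <= radinv a (fun s => (1 + s) ^- 3) t.
  rewrite -r0; apply: radinv_le => //; [exact: cont0y_cst|exact: cont0y_invX|].
  by move=> s s0; rewrite invr_ge0 exprn_ge0// addr_ge0.
rewrite ler_norml; apply/andP; split.
  apply: (@le_trans _ _ (radinv a (fun s => 0 + (- c) * (1 + s) ^- 3) t)).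
    by rewrite radE; nra.
  by apply: radinv_le => // s s0; have := fc s s0; rewrite ler_norml add0r mulNr => /andP[].
apply: (@le_trans _ _ (radinv a (fun s => 0 + c * (1 + s) ^- 3) t)).
  by apply: radinv_le => // s s0; have := fc s s0; rewrite ler_norml add0r => /andP[].
by rewrite radE; nra.
Qed.

End radinv.

(** * Smoothness classes on the half-line *)

Section ck0y.
Context {R : realType}.
Implicit Types (f g F G : R -> R) (t : R).

(** The class C^k on the closed half-line.  The derivative is quantified existentially at
    each order, so no choice of extension has to be made globally. *)
Fixpoint ck0y k f : Prop :=
  if k is i.+1 then exists2 f', deriv0y f f' & ck0y i f' else cont0y f.

Lemma eq_ck0y k f g : eq0y f g -> ck0y k f -> ck0y k g.
Proof.
case: k => [|k] fg; first exact: eq_cont0y.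
by move=> [f' df sf]; exists f' => //; apply: eq_deriv0y df.
Qed.

Lemma ck0yS k f : ck0y k.+1 f -> ck0y k f.
Proof.
elim: k f => [|k ih] f [f' df sf] /=; first exact: deriv0y_cont df.
by exists f' => //; exact: ih.
Qed.

Lemma ck0y_cst k (c : R) : ck0y k (fun=> c).
Proof.
elim: k c => [|k ih] c /=; first exact: cont0y_cst.
by exists (fun=> 0); [exact: deriv0y_cst|exact: ih].
Qed.

Lemma ck0yD k f g : ck0y k f -> ck0y k g -> ck0y k (fun t => f t + g t).
Proof.
elim: k f g => [|k ih] f g /=; first exact: cont0yD.
move=> [f' df sf] [g' dg sg]; exists (fun t => f' t + g' t); first exact: deriv0yD.
exact: ih.
Qed.

Lemma ck0yM k f g : ck0y k f -> ck0y k g -> ck0y k (fun t => f t * g t).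
Proof.
elim: k f g => [|k ih] f g; first exact: cont0yM.
move=> /[dup] /ck0yS sf [f' df sf'] /[dup] /ck0yS sg [g' dg sg'].
exists (fun t => f t * g' t + g t * f' t); first exact: deriv0yM.
by apply: ck0yD; exact: ih.
Qed.

Lemma ck0y_expR k f : ck0y k f -> ck0y k (fun t => expR (f t)).
Proof.
elim: k f => [|k ih] f.
  by apply: cont0y_comp => t; exact: continuous_expR.
move=> /[dup] /ck0yS sf [f' df sf'].
exists (fun t => expR (f t) * f' t); first exact: deriv0y_expR.
by apply: ck0yM => //; exact: ih.
Qed.

Lemma ck0y_avg k a g : ck0y k g -> ck0y k (avg a g).
Proof.
elim: k a g => [|k ih] a g; first exact: cont0y_avg.
move=> [g' dg sg]; exists (avg a.+1 g'); last exact: ih.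
apply: deriv0y_avg => //.
by case: k sg {ih} => // k [g'' dg' _]; exact: deriv0y_cont dg'.
Qed.

Lemma ck0y_cont k f : ck0y k f -> cont0y f.
Proof. by case: k => // k [f' /deriv0y_cont]. Qed.

(** The gain of one derivative that drives the bootstrap. *)
Lemma ck0y_radinv k a g : ck0y k g -> ck0y k.+1 (radinv a g).
Proof.
move=> sg; exists (fun t => 4^-1 * avg a g t).
  by apply: deriv0y_radinv; exact: ck0y_cont sg.
by apply: ck0yM; [exact: ck0y_cst|exact: ck0y_avg].
Qed.

End ck0y.

(** * The radial profile *)

Section fixpoint.
Context {R : realType}.
Implicit Types (v f g : R -> R) (t : R).

Definition bounded1 v := cont0y v /\ forall t, 0 <= t -> `|v t| <= 1.

(** Banach's fixed point theorem in the unit ball of the continuous functions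
    on the half-line, with the supremum norm: the iterates converge
    geometrically and uniformly. *)
Lemma contraction_fixpoint (Psi : (R -> R) -> (R -> R)) :
  (forall v, bounded1 v -> bounded1 (Psi v)) ->
  (forall v w (d : R), bounded1 v -> bounded1 w ->
    (forall t, 0 <= t -> `|v t - w t| <= d) ->
    forall t, 0 <= t -> `|Psi v t - Psi w t| <= d / 2) ->
  exists2 v, bounded1 v & eq0y v (Psi v).
Proof.
move=> Psi1 PsiC; pose u n := iter n Psi (fun=> 0).
have u1 n : bounded1 (u n).
  elim: n => [|n]; last exact: Psi1.
  by split; [exact: cont0y_cst|move=> t _; rewrite normr0].
have uS n t : 0 <= t -> `|u n.+1 t - u n t| <= 2^-1 ^+ n.
  elim: n t => [|n ih] t t0.
    by rewrite subr0 expr0; exact: ((u1 1%N).2 t t0).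
  by rewrite exprSr; apply: (PsiC _ _ _ (u1 n.+1) (u1 n) ih).
have uD n k t : 0 <= t -> `|u (n + k)%N t - u n t| <= 2 * 2^-1 ^+ n - 2 * 2^-1 ^+ (n + k).
  move=> t0; elim: k => [|k ih]; first by rewrite addn0 !subrr normr0.
  have := uS (n + k)%N t t0; rewrite addnS => h.
  rewrite -[u (n + k).+1 t](subrK (u (n + k)%N t)) -addrA.
  apply: le_trans (ler_normD _ _) _; rewrite exprS.
  have -> : 2 * (2^-1 * 2^-1 ^+ (n + k)) = 2^-1 ^+ (n + k) :> R by field.
  lra.
have p0 n : 0 < 2^-1 ^+ n :> R by rewrite exprn_gt0// invr_gt0.
have half0 : (fun n => 2^-1 ^+ n : R) @ \oo --> (0 : R).
  by apply: cvg_expr; rewrite ger0_norm ?invr_ge0// invf_lt1 ?ltr1n.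
have small e : 0 < e -> exists n, 2 * 2^-1 ^+ n <= e :> R.
  move=> e0; move/cvgrPdist_lt : half0 => /(_ (e / 2)).
  rewrite divr_gt0// => /(_ isT)[n _ /(_ n (leqnn n))].
  rewrite sub0r normrN ger0_norm ?(ltW (p0 n))// => h.
  by exists n; move: h; rewrite ltr_pdivlMr// mulrC => /ltW.
have ucvg t : 0 <= t -> cvgn (fun n => u n t).
  move=> t0; apply/cauchy_cvgP/cauchy_exP => e e0.
  have [n ne] : exists n, 2 * 2^-1 ^+ n <= e / 2 by apply: small; rewrite divr_gt0.
  exists (u n t); exists n => // k /= nk.
  rewrite /ball/= distrC; apply: le_lt_trans (_ : e / 2 < e); last first.
    by rewrite ltr_pdivrMr// ltr_pMr// ltr1n.
  apply: le_trans ne; rewrite -(subnKC nk); apply: le_trans (uD _ _ _ t0) _.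
  by rewrite gerBl mulr_ge0// ltW.
pose v t := limn (fun n => u n t).
have vu n t : 0 <= t -> `|v t - u n t| <= 2 * 2^-1 ^+ n.
  move=> t0; have c : `|u k t - u n t| @[k --> \oo] --> `|v t - u n t|.
    by apply: cvg_norm; apply: cvgB; [exact: ucvg|exact: cvg_cst].
  apply: (cvgr_to_le c); exists n => // k /= nk.
  rewrite -(subnKC nk); apply: le_trans (uD _ _ _ t0) _.
  by rewrite gerBl mulr_ge0// ltW.
have v1 : bounded1 v.
  split.
    move=> t; apply/cvgrPdist_le => e e0.
    have [n ne] : exists n, 2 * 2^-1 ^+ n <= e / 3 by apply: small; rewrite divr_gt0.
    have := (u1 n).1 t => /cvgrPdist_le /(_ (e / 3)); rewrite divr_gt0// => /(_ isT) un.
    near=> s.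
    have h1 := vu n _ (max0_ge0 t); have h2 := vu n _ (max0_ge0 s).
    have h3 : `|u n (Num.max 0 t) - u n (Num.max 0 s)| <= e / 3 by near: s.
    rewrite -[leLHS](_ : `|(v (Num.max 0 t) - u n (Num.max 0 t)) +
      ((u n (Num.max 0 t) - u n (Num.max 0 s)) -
       (v (Num.max 0 s) - u n (Num.max 0 s)))| = _); last by congr (`|_|); ring.
    apply: le_trans (ler_normD _ _) _.
    have := ler_normB (u n (Num.max 0 t) - u n (Num.max 0 s))
       (v (Num.max 0 s) - u n (Num.max 0 s)).
    lra.
  move=> t t0; have c : `|u k t| @[k --> \oo] --> `|v t|.
    by apply: cvg_norm; exact: ucvg.
  by apply: (cvgr_to_le c); exists 0%N => // k _; exact: (u1 k).2.
exists v => // t t0; apply/eqP; rewrite -subr_eq0 -normr_le0.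
apply/ler_addgt0Pr => e e0; rewrite add0r.
have [n ne] : exists n, 2 * 2^-1 ^+ n <= e / 2 by apply: small; rewrite divr_gt0.
have h1 : `|v t - u n.+1 t| <= e / 2.
  apply: le_trans (vu _ _ t0) _; apply: le_trans ne.
  rewrite ler_pM2l// exprS ler_piMl ?ltW// invf_lt1 ?ltr1n//.
have h2 : `|Psi v t - u n.+1 t| <= e / 2.
  apply: le_trans (PsiC v (u n) _ v1 (u1 n) (fun s s0 => vu n s s0) t t0) _.
  have := p0 n; lra.
rewrite -[leLHS](_ : `|(v t - u n.+1 t) - (Psi v t - u n.+1 t)| = _); last first.
  by congr (`|_|); ring.
by apply: le_trans (ler_normB _ _) _; lra.
Unshelve. all: by end_near. Qed.

Lemma expR_lip (x y z : R) : x <= z -> y <= z ->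
  `|expR x - expR y| <= expR z * `|x - y|.
Proof.
have H a b : a <= b -> b <= z -> expR b - expR a <= expR z * (b - a).
  move=> ab bz; have h := expR_ge1Dx (a - b); have hb := expR_gt0 b.
  have -> : expR a = expR b * expR (a - b) by rewrite -expRD; congr expR; ring.
  have hz : expR b <= expR z by rewrite ler_expR.
  apply: (@le_trans _ _ (expR b * (b - a))); last by rewrite ler_wpM2r// subr_ge0.
  by rewrite -{1}[expR b]mulr1 -mulrBr ler_pM2l//; lra.
move=> xz yz; wlog xy : x y xz yz / x <= y.
  move=> W; have [/W|/ltW yx] := leP x y; first exact.
  by rewrite distrC [`|x - y|]distrC; exact: W.
rewrite distrC [`|x - y|]distrC !ger0_norm ?subr_ge0 ?ler_expR//; exact: H.
Qed.

(** Both a stretched exponential and its product with its exponent decay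
    faster than [(1 + t)^-3]: write [e^-X] as the square of [e^(-X/2)], and
    bound [e^(X/2) = (e^(X/6))^3] below by [((1 + t) / 6)^3]. *)
Lemma expRN_le_inv3 (X t : R) : 0 <= t -> 0 <= X -> t <= X + 1 ->
  expR (- X) <= 432 * (1 + t) ^- 3 /\ X * expR (- X) <= 432 * (1 + t) ^- 3.
Proof.
move=> t0 X0 tX.
have t1 : 0 < 1 + t by rewrite ltr_pwDl.
set E := expR (- (X / 2)); have E0 : 0 < E by exact: expR_gt0.
have EX : expR (- X) = E * E by rewrite -expRD; congr expR; field.
have hE : E <= 216 * (1 + t) ^- 3.
  rewrite /E expRN -[leRHS]invrK lef_pV2 ?posrE ?expR_gt0//; last first.
    by rewrite invr_gt0 mulr_gt0// invr_gt0 exprn_gt0.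
  have -> : X / 2 = 3 * (X / 6) by field.
  rewrite expRM_natl.
  have -> : (216 * (1 + t) ^- 3)^-1 = ((1 + t) / 6) ^+ 3.
    by field; rewrite gt_eqF.
  rewrite lerXn2r ?nnegrE ?expR_ge0 ?divr_ge0 ?(ltW t1)//.
  by apply: le_trans (expR_ge1Dx _); lra.
have E1 : E <= 1 by rewrite expR_le1; lra.
have hX : X * E <= 2.
  have hh : X / 2 <= expR (X / 2) by apply: le_trans (expR_ge1Dx _); lra.
  by rewrite /E expRN ler_pdivrMr ?expR_gt0//; lra.
set I := (1 + t) ^- 3 in hE *.
have I0 : 0 < I by rewrite invr_gt0 exprn_gt0.
by rewrite EX; split; nra.
Qed.

Lemma le_expn_add1 (a : nat) (t : R) : (0 < a)%N -> 0 <= t -> t <= t ^+ a + 1.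
Proof.
move=> a0 t0; have [t1|t1] := leP t 1; first by rewrite (le_trans t1)// lerDr exprn_ge0.
by rewrite (@le_trans _ _ (t ^+ a)) ?lerDl// ler_eXnr// ltW.
Qed.

(** The unknown [v] is the highest power [L^a] of the radial operator applied
    to the solution, shifted by [A].  The shift is chosen so that [|v| <= 1] forces
    [2 (a + 1) y <= - t^a]; then the source [mu e^(2 (a + 1) y)] and its
    variation with [v] are both dominated by [(1 + t)^-3], and [mu] small makes
    the map [Psi] a contraction of the unit ball. *)
Lemma profile_exists (a : nat) : (0 < a)%N -> exists2 e : R, 0 < e &
  exists A : R, forall mu : R, `|mu| <= e -> exists v : R -> R,
  let y := iter a (radinv a) (fun t => v t - A) in
  [/\ cont0y v, eq0y v (radinv a (fun t => mu * expR ((2 * a.+1)%:R * y t))) &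
    forall t, 0 <= t -> (2 * a.+1)%:R * y t <= - t ^+ a].
Proof.
move=> a0; set p : R := (2 * a.+1)%:R; pose k : R := radinv_coef a a.
have p0 : 0 < p by rewrite ltr0n.
have k0 : 0 < k by exact: radinv_coef_gt0.
have pk0 : 0 < p * k by rewrite mulr_gt0.
(* With this D, the a-th iterate of radinv sends the constant - D to - t^a / p. *)
pose D := (p * k)^-1; have D0 : 0 < D by rewrite invr_gt0.
pose A := 1 + D.
(* The summand 1 serves the stability of the unit ball, the other one the
   contraction factor 1/2. *)
pose C := 432 * (1 + 2 * (p * k)).
have C0 : 0 < C by rewrite /C; lra.
exists C^-1; first by rewrite invr_gt0.
exists A => mu muC.
have muC1 : `|mu| * C <= 1 by rewrite -ler_pdivlMr// div1r.
pose y v := iter a (radinv a) (fun t : R => v t - A).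
pose E v t := mu * expR (p * y v t).
pose Psi v := radinv a (E v).
have cv v : cont0y v -> cont0y (fun t => v t - A).
  by move=> c; apply: cont0yD => //; exact: cont0y_cst.
have cy v : cont0y v -> cont0y (y v) by move=> c; apply: cont0y_iter_radinv; exact: cv.
have cE v : cont0y v -> cont0y (E v).
  move=> c; apply: cont0yM; first exact: cont0y_cst.
  apply: (@cont0y_comp _ _ expR); first exact: continuous_expR.
  by apply: cont0yM; [exact: cont0y_cst|exact: cy].
have yle v : bounded1 v -> forall t, 0 <= t -> p * y v t <= - t ^+ a.
  move=> [c v1] t t0.
  have : y v t <= iter a (radinv a) (fun=> - D) t.
    apply: iter_radinv_le => //; [exact: cv|exact: cont0y_cst|].
    by move=> s s0; have := v1 s s0; rewrite ler_norml /A => /andP[_]; lra.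
  rewrite iter_radinv_cst// => h.
  have -> : - t ^+ a = p * (t ^+ a * (- D * radinv_coef a a)).
    by rewrite /D -/k; field; rewrite !gt_eqF.
  by rewrite ler_pM2l.
have Xt t : 0 <= t -> 0 <= t ^+ a /\ t <= t ^+ a + 1.
  by move=> t0; split; [exact: exprn_ge0|exact: le_expn_add1].
have I0 (s : R) : 0 <= s -> 0 < (1 + s) ^- 3 by move=> s0; rewrite invr_gt0 exprn_gt0// ltr_pwDl.
have [v [cv1 v1] vP] : exists2 v, bounded1 v & eq0y v (Psi v).
  apply: contraction_fixpoint.
    move=> v v1; have c := v1.1; split; first by apply: cont0y_radinv; exact: cE.
    move=> t t0; apply: radinv_bound => //; first exact: cE.
    move=> s s0; rewrite /E normrM (gtr0_norm (expR_gt0 _)).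
    have [X0 X1] := Xt s s0; have [h1 _] := expRN_le_inv3 s0 X0 X1.
    have h2 : expR (p * y v s) <= expR (- s ^+ a) by rewrite ler_expR; exact: yle.
    have h3 := I0 s s0; have h4 := normr_ge0 mu; rewrite mul1r.
    apply: (@le_trans _ _ (`|mu| * (432 * (1 + s) ^- 3))).
      by rewrite ler_wpM2l// (le_trans h2).
    rewrite mulrA ler_piMl ?(ltW h3)//; apply: le_trans muC1.
    by rewrite ler_wpM2l// /C; lra.
  move=> v w d v1 w1 vw t t0.
  have d0 : 0 <= d by apply: le_trans (vw 0 (lexx 0)).
  have yd s : 0 <= s -> `|y v s - y w s| <= s ^+ a * (d * k).
    move=> s0.
    have Hd f g : bounded1 f -> bounded1 g -> (forall t, 0 <= t -> `|f t - g t| <= d) ->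
        y f s <= y g s + s ^+ a * (d * k).
      move=> f1 g1 fg; have := @iter_radinv_lin R a a (fun t => g t - A) (fun=> d) 1 s
        (cv g g1.1) (@cont0y_cst R d) s0.
      rewrite !mul1r iter_radinv_cst// -/(y g) => <-.
      apply: iter_radinv_le => //; first exact: (cv f f1.1).
        by apply: cont0yD; [exact: (cv g g1.1)|exact: cont0y_cst].
      by move=> r r0; have := fg r r0; rewrite ler_norml => /andP[]; lra.
    have wv r : 0 <= r -> `|w r - v r| <= d by move=> r0; rewrite distrC; exact: vw.
    have h1 := Hd v w v1 w1 vw; have h2 := Hd w v w1 v1 wv.
    by rewrite ler_norml; apply/andP; split; lra.
  have -> : Psi v t - Psi w t = radinv a (fun s => E v s + (-1) * E w s) t.
    by rewrite radinv_lin ?mulN1r//; [exact: cE v1.1|exact: cE w1.1].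
  apply: radinv_bound => //; first by rewrite divr_ge0.
    apply: cont0yD; first exact: cE v1.1.
    by apply: cont0yM; [exact: cont0y_cst|exact: cE w1.1].
  move=> s s0; rewrite mulN1r /E -mulrBr normrM.
  have h1 := expR_lip (yle v v1 s s0) (yle w w1 s s0).
  rewrite -mulrBr normrM (gtr0_norm p0) in h1.
  have [X0 X1] := Xt s s0; have [_ h2] := expRN_le_inv3 s0 X0 X1.
  have h3 := I0 s s0; have h4 := normr_ge0 mu; have h5 := yd s s0.
  apply: (@le_trans _ _ (`|mu| * (expR (- s ^+ a) * (p * (s ^+ a * (d * k)))))).
    rewrite ler_wpM2l//; apply: le_trans h1 _.
    by rewrite ler_wpM2l ?expR_ge0// ler_wpM2l// ltW.
  apply: (@le_trans _ _ (`|mu| * ((p * k * d) * (432 * (1 + s) ^- 3)))).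
    rewrite ler_wpM2l// (_ : expR _ * _ = (p * k * d) * (s ^+ a * expR (- s ^+ a))); last by ring.
    by rewrite ler_wpM2l// mulr_ge0// ltW.
  rewrite (_ : `|mu| * _ = (`|mu| * (432 * (p * k))) * (d * (1 + s) ^- 3)); last by ring.
  rewrite (_ : d / 2 * _ = 2^-1 * (d * (1 + s) ^- 3)); last by ring.
  rewrite ler_wpM2r//; first by rewrite mulr_ge0// ltW.
  have : `|mu| * (432 * (2 * (p * k))) <= 1.
    by apply: le_trans muC1; rewrite ler_wpM2l// /C; lra.
  by lra.
exists v; split => //; exact: (yle v).
Qed.
End fixpoint.

(** * Radial functions in Euclidean space *)

Section Rn.
Context {R : realType} {n : nat}.
Implicit Types (f g : 'rV[R]_n -> R) (x v : 'rV[R]_n) (phi : R -> R).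

(** A directional derivative is an ordinary derivative along the line. *)
Lemma is_derive_line f x v (h l : R) :
  is_derive h 1 (fun s : R => f (s *: v + x)) l <-> is_derive (h *: v + x) v f l.
Proof.
have E : (fun k : R => k^-1 *: (((fun s : R => f (s *: v + x)) \o shift h) (k *: (1 : R))
            - f (h *: v + x)))
       = (fun k : R => k^-1 *: ((f \o shift (h *: v + x)) (k *: v) - f (h *: v + x))).
  by apply/funext => k /=; rewrite /shift/= [k *: 1]mulr1 scalerDl addrA.
by split => -[d1 d2]; split; move: d1 d2; rewrite /derivable /derive E.
Qed.

Lemma is_derive_line0 f x v (l : R) :
  is_derive (0 : R) 1 (fun s : R => f (s *: v + x)) l <-> is_derive x v f l.
Proof. by rewrite is_derive_line scale0r add0r. Qed.

Definition sqnorm x : R := \sum_(i < n) x 0 i ^+ 2.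

Lemma sqnorm_ge0 x : 0 <= sqnorm x.
Proof. by apply: sumr_ge0 => i _; exact: sqr_ge0. Qed.

Lemma sqnorm0 : sqnorm 0 = 0.
Proof. by rewrite /sqnorm big1// => i _; rewrite mxE expr0n. Qed.

Lemma sqnorm_line x i (s : R) : sqnorm (s *: delta_mx 0 i + x) = sqnorm x + (2 * x 0 i * s + s ^+ 2).
Proof.
rewrite /sqnorm (bigD1 i)// [in RHS](bigD1 i)//= !mxE !eqxx mulr1.
rewrite (eq_bigr (fun j => x 0 j ^+ 2)); first by ring.
by move=> j ji; rewrite !mxE (negbTE ji) andbF mulr0 add0r.
Qed.

Lemma continuous_sqnorm : continuous sqnorm.
Proof.
rewrite (_ : sqnorm = fun x => \sum_(i < n) x 0 i ^+ 2)//.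
apply: continuous_big => [|i _ x].
  exact: add_continuous.
apply: (@continuous_comp _ _ _ (fun x => x 0 i) (fun t => t ^+ 2)).
  exact: coord_continuous.
exact: exprn_continuous.
Qed.

Lemma is_derive_radial phi phi1 x i : deriv0y phi phi1 ->
  is_derive x (delta_mx 0 i) (fun x => phi (sqnorm x)) (2 * x 0 i * phi1 (sqnorm x)).
Proof.
move=> [G GF dG]; apply/is_derive_line0.
rewrite (_ : (fun s => _) = G \o (fun s : R => sqnorm x + (2 * x 0 i * s + s ^+ 2))); last first.
  by apply/funext => s /=; rewrite -sqnorm_line GF// sqnorm_ge0.
have dq : is_derive (0 : R) 1 (fun s : R => sqnorm x + (2 * x 0 i * s + s ^+ 2)) (2 * x 0 i).
  have h := is_deriveD (is_derive_cst (sqnorm x) (0 : R) 1) (is_deriveD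
    (is_deriveZ (2 * x 0 i) (is_derive_id (0 : R) 1)) (is_deriveXn 1 0)).
  by apply: is_derive_eq h _; rewrite /GRing.scale/=; ring.
rewrite [X in is_derive _ _ _ X]mulrC; apply: is_derive1_comp dq.
rewrite mulr0 expr0n addr0 addr0.
by apply: dG; exact: sqnorm_ge0.
Qed.

(** An inductive form of C^k: unlike the quantification over lists of
    directions in [smooth], it supports induction on the order, which gives
    closure under products. *)
Fixpoint ckRn k f : Prop := continuous f /\
  if k is j.+1 then (forall i x, derivable f x (delta_mx 0 i)) /\
    (forall i, ckRn j (partial i f)) else True.

Lemma ckRn_cont k f : ckRn k f -> continuous f. Proof. by case: k => [|k] []. Qed.

Lemma ckRn_smooth f : (forall k, ckRn k f) -> smooth f.
Proof.
move=> sf s; have {}sf : forall k, ckRn k (foldr partial f s).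
  by elim: s => [|i s ih] k //=; have [_ [_]] := ih k.+1; exact.
by split; [exact: ckRn_cont (sf 0%N)|have [_ []] := sf 1%N].
Qed.

Lemma ckRnS k f : ckRn k.+1 f -> ckRn k f.
Proof.
elim: k f => [|k ih] f [cf [df pf]]; split => //.
by split => // i; apply: ih.
Qed.

Lemma partialE i f g : (forall x, is_derive x (delta_mx 0 i) f (g x)) -> partial i f = g.
Proof. by move=> h; apply/funext => x; rewrite /partial (@derive_val _ _ _ _ _ _ _ (h x)). Qed.

Lemma ckRn_partial k f (g : 'I_n -> 'rV[R]_n -> R) : continuous f ->
  (forall i x, is_derive x (delta_mx 0 i) f (g i x)) -> (forall i, ckRn k (g i)) ->
  ckRn k.+1 f.
Proof.
move=> cf dg sg; split => //; split => [i x|i]; last by rewrite (partialE (dg i)).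
by have [] := dg i x.
Qed.

Lemma ckRn_cst k (c : R) : ckRn k (fun=> c).
Proof.
have cc : continuous (fun _ : 'rV[R]_n => c) by exact: cst_continuous.
elim: k c cc => [|k ih] c cc; first by split.
have s0 : ckRn k (fun _ : 'rV[R]_n => 0) by apply: ih; exact: cst_continuous.
by apply: (@ckRn_partial k _ (fun _ _ => 0) cc).
Qed.

Lemma ckRnD k f g : ckRn k f -> ckRn k g -> ckRn k (fun x => f x + g x).
Proof.
have cD f' g' : continuous f' -> continuous g' -> continuous (fun x => f' x + g' x : R).
  by move=> cf cg x; exact: (continuousD (cf x) (cg x)).
elim: k f g => [|k ih] f g [cf pf] [cg pg]; first by split; [exact: cD|].
have [df sf] := pf; have [dg sg] := pg.
apply: (@ckRn_partial _ _ (fun i x => partial i f x + partial i g x) (cD _ _ cf cg)).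
  by move=> i x; exact: (is_deriveD (derivableP (df i x)) (derivableP (dg i x))).
by move=> i; exact: (ih _ _ (sf i) (sg i)).
Qed.

Lemma ckRnM k f g : ckRn k f -> ckRn k g -> ckRn k (fun x => f x * g x).
Proof.
have cM f' g' : continuous f' -> continuous g' -> continuous (fun x => f' x * g' x : R).
  by move=> cf cg x; exact: (continuousM (cf x) (cg x)).
elim: k f g => [|k ih] f g; first by move=> [cf _] [cg _]; split; [exact: cM|].
move=> /[dup] /ckRnS sf [cf [df pf]] /[dup] /ckRnS sg [cg [dg pg]].
apply: (@ckRn_partial _ _ (fun i x => f x * partial i g x + g x * partial i f x)
  (cM _ _ cf cg)).
  by move=> i x; exact: (is_deriveM (derivableP (df i x)) (derivableP (dg i x))).
by move=> i; exact: (ckRnD (ih _ _ sf (pg i)) (ih _ _ sg (pf i))).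
Qed.

Lemma is_derive_coord i j x : is_derive x (delta_mx 0 j) (fun x => x 0 i) (i == j)%:R.
Proof.
apply/is_derive_line0.
rewrite (_ : (fun s : R => _) = (fun s => s * (i == j)%:R + x 0 i)); last first.
  by apply/funext => s; rewrite !mxE eqxx.
have h : is_derive (0 : R) 1 (fun s => s * (i == j)%:R + x 0 i) _ :=
  is_deriveD (is_deriveM (is_derive_id (0 : R) 1)
    (is_derive_cst ((i == j)%:R : R) (0 : R) 1)) (is_derive_cst (x 0 i) (0 : R) 1).
by apply: is_derive_eq h _; rewrite /GRing.scale/= mulr1 mul0r add0r addr0.
Qed.

Lemma ckRn_coord k i : ckRn k (fun x => x 0 i).
Proof.
case: k => [|k]; first by (split => //; exact: coord_continuous).
apply: (@ckRn_partial _ _ (fun j x => (i == j)%:R)) => [|j x|j].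
- exact: coord_continuous.
- exact: is_derive_coord.
- exact: ckRn_cst.
Qed.

Lemma continuous_radial phi : cont0y phi -> continuous (fun x => phi (sqnorm x)).
Proof.
move=> cp; rewrite (_ : (fun x => _) = (fun t => phi (Num.max 0 t)) \o sqnorm).
  by move=> x; apply: continuous_comp; [exact: continuous_sqnorm|exact: cp].
by apply/funext => x /=; rewrite max0_id// sqnorm_ge0.
Qed.

(** The partial derivatives of a radial function are products of a coordinate
    and a radial function, so the class is preserved order by order. *)
Lemma ckRn_radial k phi : ck0y k phi -> ckRn k (fun x => phi (sqnorm x)).
Proof.
elim: k phi => [|k ih] phi; first by (move=> cp; split => //; exact: continuous_radial).
move=> [phi1 dphi s1].
apply: (@ckRn_partial _ _ (fun i x => 2 * x 0 i * phi1 (sqnorm x))) => [|i x|i].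
- by apply: continuous_radial; exact: deriv0y_cont dphi.
- exact: is_derive_radial.
- apply: ckRnM; last exact: ih.
  by apply: ckRnM; [exact: ckRn_cst|exact: ckRn_coord].
Qed.

Lemma laplacian_radial phi phi1 phi2 (c : R) x : deriv0y phi phi1 -> deriv0y phi1 phi2 ->
  laplacian (fun x => c * phi (sqnorm x)) x
  = c * (4 * sqnorm x * phi2 (sqnorm x) + (2 * n)%:R * phi1 (sqnorm x)).
Proof.
move=> d1 d2; rewrite /laplacian.
have e i : partial i (partial i (fun x => c * phi (sqnorm x)))
    = fun x => c * (2 * phi1 (sqnorm x) + 4 * x 0 i ^+ 2 * phi2 (sqnorm x)).
  have -> : partial i (fun x => c * phi (sqnorm x)) = (fun x => c * (2 * x 0 i * phi1 (sqnorm x))).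
    by apply: partialE => y; exact: (is_deriveZ c (is_derive_radial y i d1)).
  apply: partialE => y.
  have h : is_derive y (delta_mx 0 i) (fun x => c * (2 * (x 0 i * phi1 (sqnorm x)))) _ :=
    is_deriveZ c (is_deriveZ 2 (is_deriveM (is_derive_coord i i y) (is_derive_radial y i d2))).
  rewrite (_ : (fun x => c * (2 * x 0 i * _)) = (fun x => c * (2 * (x 0 i * phi1 (sqnorm x))))).
    by apply: is_derive_eq h _; rewrite /GRing.scale/= eqxx mulr1; ring.
  by apply/funext => z; rewrite -!mulrA.
under eq_bigr do rewrite e.
rewrite -mulr_sumr big_split/= sumr_const card_ord -mulr_suml -mulr_sumr -/(sqnorm x).
by rewrite -mulr_natl natrM; ring.
Qed.

End Rn.

(** * Integrability *)

Section integral.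
Context {R : realType}.

Lemma measurable_prod_tnth d (T : measurableType d) (h : T -> R) n :
  measurable_fun setT h ->
  measurable_fun setT (fun t : n.-tuple T => \prod_(i < n) h (tnth t i)).
Proof.
move=> mh; apply: measurable_prod => i _.
by apply: measurableT_comp => //; exact: measurable_tnth.
Qed.

Lemma integral_tprod_prod d (T : measurableType d)
    (mu : {sigma_finite_measure set T -> \bar R}) (h : T -> R) n :
  measurable_fun setT h -> (forall x, 0 <= h x) ->
  (\int[tprod mu n]_t (\prod_(i < n) h (tnth t i))%:E
   = (\int[mu]_x (h x)%:E) ^+ n)%E.
Proof.
move=> mh h0; elim: n => [|n ih]; last rewrite expeS; rewrite /=.
  rewrite integral_dirac//; last first.
    by apply/measurable_EFinP; exact: measurable_prod_tnth.
  by rewrite diracT mul1e big_ord0.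
rewrite /tprod_succ ge0_integral_pushforward//; first last.
- by move=> t _; rewrite lee_fin prodr_ge0.
- by apply/measurable_EFinP; exact: measurable_prod_tnth.
- exact: measurable_tcons.
rewrite preimage_setT.
have mG : measurable_fun [set: T * n.-tuple T]
    ((fun t => (\prod_(i < n.+1) h (tnth t i))%:E) \o @tcons _ T n).
  apply: measurableT_comp; last exact: measurable_tcons.
  by apply/measurable_EFinP; exact: measurable_prod_tnth.
rewrite fubini_tonelli1//; last by move=> p; rewrite lee_fin prodr_ge0.
rewrite /fubini_F/=.
have step x : (\int[tprod mu n]_y (\prod_(i < n.+1) h (tnth (tcons (x, y)) i))%:E
    = (h x)%:E * (\int[mu]_x (h x)%:E) ^+ n)%E.
  rewrite -ih -ge0_integralZl//.
  - apply: eq_integral => y _; rewrite -EFinM big_ord_recl tnth0; congr (_ * _)%:E.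
    by apply: eq_bigr => i _; rewrite tnthS.
  - by apply/measurable_EFinP; exact: measurable_prod_tnth.
  - by move=> t _; rewrite lee_fin prodr_ge0.
  - by rewrite lee_fin.
rewrite (eq_integral _ _ (fun x _ => step x)).
rewrite ge0_integralZr//.
- by apply/measurable_EFinP.
- by move=> x _; rewrite lee_fin.
- by apply: expe_ge0; apply: integral_ge0 => x _; rewrite lee_fin.
Qed.

(** The exponential of [- |x|^2] is a product of one-dimensional Gaussians. *)
Lemma integral_exp_lt_oo n (phi : R -> R) (c : R) : cont0y phi ->
  (forall t, 0 <= t -> phi t <= c - t) ->
  (integral_Rn (fun x : 'rV[R]_n => (expR (phi (sqnorm x)))%:E) < +oo)%E.
Proof.
move=> cphi phic; rewrite /integral_Rn.
have e1 (t : n.-tuple R) : sqnorm (\row_i tnth t i) = \sum_(i < n) tnth t i ^+ 2.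
  by apply: eq_bigr => i _; rewrite mxE.
have mg : measurable_fun setT (fun t : n.-tuple R => \prod_(i < n) gauss_fun (tnth t i)).
  by apply: measurable_prod_tnth; exact: measurable_gauss_fun.
have mF : measurable_fun setT
    (fun t : n.-tuple R => expR (phi (sqnorm (\row_i tnth t i)))).
  have mphi : measurable_fun setT (fun s : R => expR (phi (Num.max 0 s))).
    apply: continuous_measurable_fun.
    by apply: (@cont0y_comp _ _ expR) => //; exact: continuous_expR.
  rewrite (_ : (fun t => _) = (fun s : R => expR (phi (Num.max 0 s))) \o
    (fun t : n.-tuple R => \sum_(i < n) tnth t i ^+ 2)); last first.
    by apply/funext => t /=; rewrite -e1 max0_id// sqnorm_ge0.
  apply: measurableT_comp => //; apply: measurable_sum => i.
  by apply: measurable_funX; exact: measurable_tnth.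
have le t : ((expR (phi (sqnorm (\row_i tnth t i))))%:E <=
    (expR c)%:E * (\prod_(i < n) gauss_fun (tnth t i))%:E)%E.
  rewrite -EFinM lee_fin /gauss_fun -expR_sum -expRD ler_expR sumrN -e1.
  exact: phic (sqnorm_ge0 _).
apply: (@le_lt_trans _ _ (\int[tprod lebesgue_measure n]_t
    ((expR c)%:E * (\prod_(i < n) gauss_fun (tnth t i))%:E))%E).
  apply: ge0_le_integral; first exact: measurableT.
  - by move=> t _; rewrite lee_fin expR_ge0.
  - exact/measurable_EFinP.
  - by apply: emeasurable_funM => //; exact/measurable_EFinP.
  - by move=> t _; exact: le.
have g0 (x : R) : 0 <= gauss_fun x by exact: gauss_fun_ge0.
rewrite ge0_integralZl; first last.
- by rewrite lee_fin expR_ge0.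
- by move=> t _; rewrite lee_fin prodr_ge0.
- exact/measurable_EFinP.
- exact: measurableT.
rewrite integral_tprod_prod//; last exact: measurable_gauss_fun.
by rewrite integralT_gauss -EFin_expe -EFinM ltry.
Qed.
End integral.

(** * Existence in dimension at least four *)

Section existence.
Context {R : realType}.

(** The constant [b] accommodates the two shifts in the construction: [- B] in
    the solution and [- A] in its highest iterated Laplacian. *)
Lemma laplacian_radinv a (g : R -> R) (c b : R) (x : 'rV[R]_(2 * a.+1)) : ck0y 1 g ->
  laplacian (fun x => c * (radinv a g (sqnorm x) + b)) x = c * g (sqnorm x).
Proof.
move=> sg; have [g' dg cg'] := sg.
have d1 : deriv0y (fun t => radinv a g t + b) (fun t => 4^-1 * avg a g t + 0).
  by apply: deriv0yD; [apply: deriv0y_radinv; exact: deriv0y_cont dg|exact: deriv0y_cst].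
have d2 : deriv0y (fun t => 4^-1 * avg a g t + 0)
    (fun t => 4^-1 * avg a.+1 g' t + avg a g t * 0 + 0).
  apply: deriv0yD; last exact: deriv0y_cst.
  by apply: deriv0yM; [exact: deriv0y_cst|exact: deriv0y_avg].
rewrite (laplacian_radial c x d1 d2) -(avg_ode a dg cg' (sqnorm_ge0 x)).
by rewrite !natrM; field.
Qed.

(** Because [radinv] produces functions vanishing at [0], the shift [- B] is the
    value at the origin, which tells the solutions apart. *)
Lemma solution_exists (a : nat) (Q : R) : (0 < a)%N -> Q < 0 ->
  exists b, forall B, b <= B -> exists u : 'rV[R]_(2 * a.+1) -> R,
    [/\ is_solution Q a.+1 u, radially_symmetric u & u 0 = - B].
Proof.
move=> a0 Q0; have [e e0 [A HA]] := @profile_exists R a a0.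
set p : R := (2 * a.+1)%:R in HA.
have p1 : 1 <= p by rewrite ler1n.
have qe : 0 < - Q / e by rewrite divr_gt0// oppr_gt0.
exists (- Q / e) => B bB.
(* The sign turns (- Delta)^m into Delta^m, and the exponential absorbs the
   shift of the solution by - B. *)
pose mu := (-1) ^+ a.+1 * Q * expR (- (p * B)).
have mue : `|mu| <= e.
  rewrite !normrM normrX normrN normr1 expr1n mul1r ltr0_norm//.
  rewrite gtr0_norm ?expR_gt0// expRN ler_pdivrMr ?expR_gt0//.
  rewrite -ler_pdivrMl// mulrC; apply: (@le_trans _ _ (1 + p * B)); last exact: expR_ge1Dx.
  nra.
have [v] := HA mu mue; cbv zeta.
pose y j := iter j (radinv a) (fun t => v t - A).
rewrite -/(y a) => -[cv vE yle].
have sy k j : ck0y k v -> ck0y k (y j).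
  move=> sv; elim: j => [|j ih]; first by apply: ck0yD => //; exact: ck0y_cst.
  by apply: ck0yS; exact: ck0y_radinv.
pose E t := mu * expR (p * y a t).
have sE k : ck0y k v -> ck0y k E.
  move=> sv; apply: ck0yM; first exact: ck0y_cst.
  apply: ck0y_expR; apply: ck0yM; first exact: ck0y_cst.
  exact: sy.
(* Bootstrap: v is a primitive of an average of a function of v. *)
have sv k : ck0y k v.
  elim: k => [//|k ih]; apply: (@eq_ck0y _ _ (radinv a E)).
    by move=> t t0; rewrite vE.
  by apply: ck0y_radinv; exact: sE.
pose phi t := y a t + - B.
pose u (x : 'rV[R]_(2 * a.+1)) := phi (sqnorm x).
exists u; split.
- split.
  + apply: ckRn_smooth => k; apply: ckRn_radial.
    by apply: ck0yD; [exact: sy|exact: ck0y_cst].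
  + have step j : (j <= a)%N -> iter j (fun f y => - laplacian f y) u =
       (fun x => (-1) ^+ j * (y (a - j)%N (sqnorm x) + if j == 0%N then - B else 0)).
      elim: j => [_|j ih ja]; first by apply/funext => x; rewrite expr0 mul1r subn0.
      rewrite iterS ih ?(ltnW ja)//; apply/funext => x.
      rewrite -(subnSK ja) [y _.+1]/(radinv a (y _)) laplacian_radinv; last exact: sy.
      by rewrite addr0 exprS mulN1r mulNr.
    move=> x; rewrite iterS step// subnn.
    rewrite (_ : (fun x => _) = (fun x => (-1) ^+ a * (radinv a E (sqnorm x) + - A))); last first.
      apply/funext => z; rewrite gtn_eqF// addr0 [y 0%N _]/(v _ - A).
      by rewrite (vE _ (sqnorm_ge0 z)).
    rewrite laplacian_radinv; last exact: sE.
    rewrite -mulNr -mulN1r -exprS /E /mu /u /phi -/p mulrDr mulrN expRD.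
    have h : (-1) ^+ a.+1 * (-1) ^+ a.+1 = 1 :> R by rewrite -exprMn mulrNN mulr1 expr1n.
    rewrite -[RHS]mul1r -[X in _ = X * _]h; ring.
  + apply: (@integral_exp_lt_oo R _ (fun t => p * phi t) (1 - p * B)).
      apply: cont0yM; first exact: cont0y_cst.
      exact: ck0y_cont (ck0yD (sy 0%N a (sv 0%N)) (ck0y_cst _ _)).
    move=> t t0; have := yle t t0; have := le_expn_add1 a0 t0; rewrite /phi mulrDr mulrN.
    lra.
- move=> x z; rewrite /eucl_norm => /eqP; rewrite eqr_sqrt ?sqnorm_ge0//.
  by rewrite /u => /eqP; rewrite /sqnorm => ->.
- rewrite /u /phi sqnorm0.
  suff -> : y a 0 = 0 by rewrite add0r.
  by have -> : y a = radinv a (y a.-1); [rewrite /y -iterS prednK|exact: radinv0].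
Qed.

Lemma two_solutions (m : nat) (Q : R) : (2 <= m)%N -> Q < 0 ->
  exists u v : 'rV[R]_(2 * m) -> R,
      [/\ is_solution Q m u, radially_symmetric u,
          is_solution Q m v, radially_symmetric v & u <> v].
Proof.
case: m => [//|a]; rewrite ltnS => a0 Q0.
have [b H] := solution_exists a0 Q0.
have [u [u1 u2 u0]] := H b (lexx _).
have [v [v1 v2 v0]] : exists v : 'rV[R]_(2 * a.+1) -> R,
    [/\ is_solution Q a.+1 v, radially_symmetric v & v 0 = - (b + 1)].
  by apply: H; rewrite lerDl.
exists u, v; split => // uv; move: v0; rewrite -uv u0; lra.
Qed.
End existence.

(** * Nonexistence in dimension two *)

Section nonexistence.
Context {R : realType}.

Lemma second_derive_max (g g1 : R -> R) (d l : R) : 0 < d ->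
  (forall h : R, `|h| < d -> is_derive h 1 g (g1 h)) ->
  (forall h, `|h| < d -> g h <= g 0) ->
  is_derive (0 : R) 1 g1 l -> l <= 0.
Proof.
move=> d0 dg gmax dl; have N0 : `|0 : R| < d by rewrite normr0.
have inb (h : R) : (h \in `]-d, d[) = (`|h| < d) by rewrite in_itv/= ltr_norml.
have g10 : g1 0 = 0.
  have d1 := dg 0 N0.
  have d2 : is_derive (0 : R) 1 g 0.
    apply: (@derive1_at_max _ g (- d) d 0).
    - by rewrite lerNl (le_trans _ (ltW d0))// oppr_le0 ltW.
    - by move=> t; rewrite inb => /dg [].
    - by rewrite inb.
    - by move=> t; rewrite inb; exact: gmax.
  by rewrite -[LHS](@derive_val _ _ _ _ _ _ _ d1) (@derive_val _ _ _ _ _ _ _ d2).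
rewrite leNgt; apply/negP => l0.
have [k [kE kc k0]] := (is_derive1_caratheodory g1 0 l).1 dl.
have kp : \forall z \near (0 : R), 0 < k z.
  by apply: (cvgr_gt _ kc); rewrite k0.
have [e e0 ke] : exists2 e : R, 0 < e & forall z : R, `|z| < e -> 0 < k z.
  have /nbhs_ballP[e e0 H] := kp; exists e => // z ze; apply: H.
  by rewrite /ball/= sub0r normrN.
pose h := Num.min d e / 2.
have m0 : 0 < Num.min d e by rewrite lt_min d0.
have h0 : 0 < h by rewrite divr_gt0.
have hm : h < Num.min d e by rewrite ltr_pdivrMr// ltr_pMr// ltr1n.
have [hd he] : h < d /\ h < e by move: hm; rewrite lt_min => /andP[].
have dgi (x : R) : x \in `]0, h[ -> is_derive x 1 g (g1 x).
  rewrite in_itv/= => /andP[x0 xh]; apply: dg; rewrite gtr0_norm//; exact: lt_trans hd.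
have cg : {within `[0, h], continuous g}.
  apply: derivable_within_continuous => x; rewrite in_itv/= => /andP[x0 xh].
  by have [] : is_derive x 1 g (g1 x) by apply: dg; rewrite ger0_norm// (le_lt_trans xh).
have [c] := MVT h0 dgi cg; rewrite in_itv/= => /andP[c0 ch] e1.
have : 0 < g1 c * (h - 0).
  have gk : g1 c = k c * c by have := kE c; rewrite g10 !subr0.
  rewrite gk subr0 !mulr_gt0// ke// gtr0_norm//.
  exact: lt_trans he.
rewrite -e1 subr_gt0 ltNge gmax// gtr0_norm//.
Qed.

Lemma compact_sqnorm_le n (rho : R) : compact [set x : 'rV[R]_n | sqnorm x <= rho].
Proof.
apply: bounded_closed_compact.
  exists (1 + rho); split; first exact: num_real.
  move=> M hM x /= Ax; rewrite [leLHS]mx_normrE.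
  apply/bigmax_leP; split => [|[i j] _ /=].
    apply: le_trans (ltW hM); rewrite addr_ge0//; exact: le_trans (sqnorm_ge0 x) Ax.
  rewrite (ord1 i); apply: le_trans (ltW hM).
  have : x 0 j ^+ 2 <= rho.
    apply: le_trans Ax; rewrite /sqnorm (bigD1 j)//= lerDl.
    by apply: sumr_ge0 => k _; exact: sqr_ge0.
  by rewrite ler_norml => h; apply/andP; split; nra.
have := @closed_le R rho; apply: preimage_closed.
by move=> x _; exact: continuous_sqnorm.
Qed.

Lemma is_derive_quad (s b h : R) :
  is_derive h 1 (fun h : R => s + (2 * b * h + h ^+ 2)) (2 * b + 2 * h).
Proof.
have H := is_deriveD (is_derive_cst s h 1) (is_deriveD
  (is_deriveZ (2 * b) (is_derive_id h 1)) (is_deriveXn 1 h)).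
by apply: is_derive_eq H _; rewrite /GRing.scale/=; ring.
Qed.

(** The second derivative test for [u + ln (rho - q)] along a coordinate line,
    where [q h] is the squared norm of the point at parameter [h]. *)
Lemma second_partial_bound (u u1 : R -> R) (u2 s b rho : R) :
  (forall h : R, is_derive h 1 u (u1 h)) -> is_derive (0 : R) 1 u1 u2 ->
  s < rho ->
  (forall h, s + (2 * b * h + h ^+ 2) <= rho ->
    (rho - (s + (2 * b * h + h ^+ 2))) * expR (u h) <= (rho - s) * expR (u 0)) ->
  u2 <= 2 / (rho - s) + 4 * b ^+ 2 / (rho - s) ^+ 2.
Proof.
move=> du du1 srho umax.
pose q (h : R) : R := s + (2 * b * h + h ^+ 2).
have q0 : q 0 = s by rewrite /q mulr0 expr0n !addr0.
have qc : {for 0, continuous q}.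
  by apply/differentiable_continuous/derivable1_diffP; case: (is_derive_quad s b 0).
have [d d0 dP] : exists2 d : R, 0 < d & forall h : R, `|h| < d -> q h < rho.
  have /nbhs_ballP[d d0 H] : \forall z \near (0 : R), q z < rho.
    by apply: (cvgr_lt _ qc); rewrite q0.
  by exists d => // z zd; apply: H; rewrite /ball/= sub0r normrN.
pose g h := u h + ln (rho - q h).
pose g1 h := u1 h - (2 * b + 2 * h) / (rho - q h).
have drq (h : R) : is_derive h 1 (fun h => rho - q h) (- (2 * b + 2 * h)).
  have H := is_deriveB (is_derive_cst rho h 1) (is_derive_quad s b h).
  by apply: is_derive_eq H _; rewrite sub0r.
have dg (h : R) : `|h| < d -> is_derive h 1 g (g1 h).
  move=> hd; have w0 : 0 < rho - q h by rewrite subr_gt0 dP.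
  have H := is_deriveD (du h) (@is_derive1_comp R (@ln R) (fun h => rho - q h) h _ _
    (is_derive1_ln w0) (drq h)).
  by apply: is_derive_eq H _; rewrite /g1 mulrN mulrC.
have gm h : `|h| < d -> g h <= g 0.
  move=> hd; have w0 : 0 < rho - q h by rewrite subr_gt0 dP.
  rewrite -ler_expR /g !expRD !lnK ?posrE// ?q0 ?subr_gt0//.
  by rewrite mulrC [leRHS]mulrC; apply: umax; rewrite -/(q h) ltW// dP.
have wn : rho - q 0 != 0 by rewrite q0 gt_eqF// subr_gt0.
have dl : is_derive (0 : R) 1 g1 (u2 - (2 / (rho - s) + 4 * b ^+ 2 / (rho - s) ^+ 2)).
  have dn : is_derive (0 : R) 1 (fun h : R => 2 * b + 2 * h) 2.
    have H := is_deriveD (is_derive_cst (2 * b) (0 : R) 1) (is_deriveZ 2 (is_derive_id (0 : R) 1)).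
    by apply: is_derive_eq H _; rewrite add0r /GRing.scale/= mulr1.
  have H := is_deriveB du1 (is_deriveM dn (@is_deriveV R (fun h => rho - q h) 0 _ 1 wn (drq 0))).
  apply: is_derive_eq H _; rewrite /GRing.scale/= q0; field.
  by rewrite gt_eqF// subr_gt0.
by have := second_derive_max d0 dg gm dl; rewrite subr_le0.
Qed.

(** The point is a maximum of [(rho - |x|^2) e^u] on the closed ball of squared
    radius [rho]; it is interior because this function vanishes on the sphere. *)
Lemma laplacian_le_at_max n (u : 'rV[R]_n -> R) (rho : R) : smooth u -> 0 < rho ->
  exists2 x, sqnorm x < rho & [/\ rho * expR (u 0) <= (rho - sqnorm x) * expR (u x) &
   laplacian u x <= (2 * n)%:R / (rho - sqnorm x) + 4 * sqnorm x / (rho - sqnorm x) ^+ 2].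
Proof.
move=> su rho0.
have cu : continuous u := (su [::]).1.
pose G x := (rho - sqnorm x) * expR (u x).
have cG : continuous G.
  move=> x; have c1 := continuousB (@cst_continuous 'rV[R]_n R rho x) (@continuous_sqnorm R n x).
  exact: (continuousM c1 (continuous_comp (cu x) (@continuous_expR R (u x)))).
have A0 : [set x : 'rV[R]_n | sqnorm x <= rho] !=set0 by exists 0; rewrite /= sqnorm0 ltW.
have [x] := compact_EVT_max A0 (@compact_sqnorm_le n rho) (continuous_subspaceT cG).
rewrite inE/= => xr xmax.
have x0 : rho * expR (u 0) <= G x.
  have := xmax 0; rewrite inE/= sqnorm0 /G sqnorm0 subr0; apply; exact: ltW.
have sx : sqnorm x < rho.
  rewrite lt_neqAle xr andbT; apply/eqP => e.
  by move: x0; rewrite /G e subrr mul0r leNgt mulr_gt0// expR_gt0.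
exists x => //; split => //.
have b i : partial i (partial i u) x <= 2 / (rho - sqnorm x) + 4 * x 0 i ^+ 2 / (rho - sqnorm x) ^+ 2.
  apply: (@second_partial_bound (fun h => u (h *: delta_mx 0 i + x))
    (fun h => partial i u (h *: delta_mx 0 i + x))) => //.
  - by move=> h; apply/is_derive_line/derivableP; exact: ((su [::]).2 i).
  - by apply/is_derive_line0/derivableP; exact: ((su [:: i]).2 i).
  - move=> h; rewrite -sqnorm_line scale0r add0r => hr.
    by have := xmax (h *: delta_mx 0 i + x); rewrite inE; apply.
apply: le_trans (ler_sum _ (fun i _ => b i)) _.
rewrite big_split/= sumr_const card_ord -mulr_suml -mulr_sumr -/(sqnorm x).
by rewrite -[X in X + _ <= _]mulr_natl natrM lerD2r mulrA [n%:R * 2]mulrC.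
Qed.

Lemma no_solution_dim2 (Q : R) : Q < 0 -> ~ exists u : 'rV[R]_(2 * 1) -> R, is_solution Q 1 u.
Proof.
move=> Q0 [u [su eu _]].
have eu' x : laplacian u x = - Q * expR (2 * u x).
  have : - laplacian u x = Q * expR (2 * u x) := eu x.
  by move/eqP; rewrite eqr_oppLR mulNr => /eqP.
set e := expR (u 0); have e0 : 0 < e by exact: expR_gt0.
have qe0 : 0 < - Q * e ^+ 2 by rewrite mulr_gt0 ?exprn_gt0// oppr_gt0.
(* The bound at the maximum yields - Q e^2 rho <= 4. *)
pose rho := 5 / (- Q * e ^+ 2).
have rho0 : 0 < rho by rewrite divr_gt0.
have [x sx [xm xl]] := laplacian_le_at_max su rho0.
have w0 : 0 < rho - sqnorm x by rewrite subr_gt0.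
move: xl; rewrite eu' -[(2 * (2 * 1))%N]/4%N expRM_natl.
rewrite (_ : 4%:R / _ + _ = 4 * rho / (rho - sqnorm x) ^+ 2); last first.
  by field; rewrite gt_eqF.
rewrite ler_pdivlMr ?exprn_gt0// -mulrA -exprMn [expR _ * _]mulrC => h1.
have h2 : (rho * e) ^+ 2 <= ((rho - sqnorm x) * expR (u x)) ^+ 2.
  by rewrite lerXn2r// nnegrE mulr_ge0 ?expR_ge0// ltW.
have h3 : - Q * (rho * e) ^+ 2 <= 4 * rho.
  by apply: le_trans h1; rewrite ler_wpM2l// oppr_ge0 ltW.
have h4 : - Q * (rho * e) ^+ 2 = 5 * rho.
  by rewrite /rho; field; rewrite gt_eqF ?lt_eqF.
by move: h3; rewrite h4; lra.
Qed.

End nonexistence.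

Theorem theorem1 (R : realType) (Q : R) (hQ : Q < 0) :
  (~ exists u : 'rV[R]_(2 * 1) -> R, is_solution Q 1 u) /\
  (forall m : nat, (2 <= m)%N ->
    exists u v : 'rV[R]_(2 * m) -> R,
      [/\ is_solution Q m u, radially_symmetric u,
          is_solution Q m v, radially_symmetric v & u <> v]).
Proof.
by split=> [|m m2]; [exact: no_solution_dim2|exact: two_solutions].
Qed.
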